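(* Let $k,r,n$ be integers and write $n-1=p(k-2)+q$ with integers $p\ge 0$ and $0\le q\le k-3$. Let $\mathcal{H}=\{K_r\}\cup\mathcal{C}_{\ge k}$ and let $f(n,k,r)=p\,\mathrm{ex}(k-1,K_r)+\mathrm{ex}(q+1,K_r)$. If $k\ge 6$ is even and $\lfloor (k-1)/2\rfloor+2\le r<k\le n$, then $$\mathrm{ex}(n,\mathcal{H})=f(n,k,r).$$ If $k\ge 5$ is odd and $\lfloor (k-1)/2\rfloor+2\le r<k\le n$, then $$\mathrm{ex}(n,\mathcal{H})=\max\{f(n,k,r),\,e(G_1)\},$$ where $G_1=K_{\lfloor (k-1)/2\rfloor}\vee I_{\,n-\lfloor (k-1)/2\rfloor}$.
   Context: Graphs are finite and simple; $e(G)$ is the number of edges of $G$. $\mathcal{C}_{\ge k}$ is the set of all cycles of length at least $k$, and $\{K_r,\mathcal{C}_{\ge k}\}$ denotes the family consisting of $K_r$ and all these cycles. For a family $\mathcal{H}$ of graphs, a graph is $\mathcal{H}$-free if it contains no member of $\mathcal{H}$ as a (not necessarily induced) subgraph; $\mathrm{ex}(n,\mathcal{H})$ is the maximum number of edges in an $n$-vertex $\mathcal{H}$-free graph, and $\mathrm{ex}(n,H)$ means $\mathrm{ex}(n,\{H\})$. By Turán's theorem $\mathrm{ex}(m,K_r)$ is the number of edges of the balanced complete $(r-1)$-partite graph $T(m,r-1)$ on $m$ vertices (empty parts allowed when $m<r-1$). $I_m$ is the graph with $m$ vertices and no edges. The join $F_1\vee F_2$ of vertex-disjoint graphs is obtained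 from $F_1\cup F_2$ by joining every vertex of $F_1$ to every vertex of $F_2$. *)

(* Defs.v *)
From HB Require Import structures.
From mathcomp Require Import all_boot.
From mathcomp Require Import boolp.

Set Implicit Arguments.
Unset Strict Implicit.
Unset Printing Implicit Defensive.

Record sgraph (V : finType) := SGraph {
  edges : {set {set V}};
  edges_card2 : [forall e in edges, #|e| == 2] }.

HB.instance Definition _ (V : finType) := [isSub for @edges V].
HB.instance Definition _ (V : finType) := [Finite of sgraph V by <:].

Definition adj (V : finType) (G : sgraph V) : rel V :=
  fun x y => [set x; y] \in edges G.

Definition num_edges (V : finType) (G : sgraph V) : nat := #|edges G|.

(* The simple graph of an arbitrary relation: x and y are adjacent iff
   x != y and (R x y or R y x). *)
Definition rel_edges (V : finType) (R : rel V) : {set {set V}} :=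
  [set [set u.1; u.2] | u : V * V & (u.1 != u.2) && R u.1 u.2].

Lemma rel_edges_card2 (V : finType) (R : rel V) :
  [forall e in rel_edges R, #|e| == 2].
Proof.
apply/forall_inP => e /imsetP[u]; rewrite inE => /andP[ne _] ->.
by rewrite cards2 ne.
Qed.

Definition graph_of_rel (V : finType) (R : rel V) : sgraph V :=
  SGraph (rel_edges_card2 R).

Lemma adj_graph_of_rel (V : finType) (R : rel V) (x y : V) :
  adj (graph_of_rel R) x y = (x != y) && (R x y || R y x).
Proof.
apply/imsetP/andP => [[[a b]] | [xy /orP[h|h]]].
- rewrite inE /= => /andP[ab Rab] E.
  have /set2P ha : a \in [set x; y] by rewrite E set21.
  have /set2P hb : b \in [set x; y] by rewrite E set22.
  case: ha hb ab Rab => -> [] -> ab Rab; move: ab; rewrite ?eqxx // => ab.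
    by rewrite ab Rab.
  by rewrite eq_sym ab Rab orbT.
- by exists (x, y); rewrite ?inE /= ?xy.
- by exists (y, x); rewrite ?inE /= 1?eq_sym ?xy // setUC.
Qed.

Definition complete_graph (V : finType) : sgraph V :=
  graph_of_rel (fun _ _ : V => true).

Definition empty_graph (V : finType) : sgraph V :=
  graph_of_rel (fun _ _ : V => false).

(* [ordS] is the cyclic successor on 'I_l; this is the cycle C_l for l >= 3. *)
Definition cycle_graph (l : nat) : sgraph 'I_l :=
  graph_of_rel (fun i j : 'I_l => j == ordS i).

Definition join_rel (V1 V2 : finType) (F1 : sgraph V1) (F2 : sgraph V2) :
    rel (V1 + V2)%type :=
  fun u v => match u, v with
             | inl x, inl y => adj F1 x y
             | inr x, inr y => adj F2 x y
             | _, _ => true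
             end.

Definition join (V1 V2 : finType) (F1 : sgraph V1) (F2 : sgraph V2) :
    sgraph (V1 + V2)%type :=
  graph_of_rel (join_rel F1 F2).

(* Not necessarily induced: non-edges of H are unconstrained. *)
Definition contains (V W : finType) (G : sgraph V) (H : sgraph W) : Prop :=
  exists f : W -> V,
    injective f /\ forall x y : W, adj H x y -> adj G (f x) (f y).

Definition family := forall W : finType, sgraph W -> Prop.

Inductive fam1 (W : finType) (H : sgraph W) : family :=
  Fam1 : fam1 H H.

Inductive cycles_ge (k : nat) : family :=
  CyclesGe (l : nat) of 3 <= l & k <= l : cycles_ge k (cycle_graph l).

Definition famU (F1 F2 : family) : family :=
  fun W H => F1 W H \/ F2 W H.

Definition free (F : family) (V : finType) (G : sgraph V) : Prop :=
  forall (W : finType) (H : sgraph W), F W H -> ~ contains G H.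

(* The maximum is 0 in the degenerate case where no n-vertex graph is F-free. *)
Definition ex (n : nat) (F : family) : nat :=
  \max_(G : sgraph 'I_n | `[< free F G >]) num_edges G.

(* Main.v *)
Require Import Defs.
From mathcomp Require Import all_boot boolp.
From mathcomp Require Import zify.

(** Write h for the integer part of (k-1)/2 and t(m) for ex(m, K_r).

    Lower bound.  An extremal K_r-free graph on fewer than k vertices has no
    cycle of length k or more.  Gluing two graphs at a single vertex creates
    neither a clique nor a cycle that was not inside one of them, so p extremal
    graphs on k-1 vertices and one on q+1 vertices glue to a windmill with
    f(n,k,r) edges ([ex_windmill]).  In K_h joined to an independent set every
    cycle has length at most 2h, which is k-1 for odd k; this gives e(G_1).

    Upper bound, by strong induction on the number of vertices
    ([upper_bound]).  As k-1 <= 2(r-1), every Turan number t(m) with m < k has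
    the form m(m-1)/2 - max(0, m-r+1); its increments do not decrease, and
    hence the windmill bound is superadditive in n-1.  A graph with fewer than
    k vertices is bounded by t(n).  A graph that falls apart when some vertex z
    is deleted is covered by two smaller graphs that share z, and the bounds for
    these add up ([cut_cover], [edge_bound_add]).

    There remains a 2-connected graph G on n >= k vertices, treated by the
    disintegration method of Kopylov ([block_bound]).  Extend G to a graph G'
    that is edge-maximal without cycles of length at least k; clique-freeness
    may be lost in G' but still holds for G.  In G' non-adjacent vertices are
    joined by a path with at least k vertices, and [path_degree_sum] says that
    the end vertices of such a path have together fewer than k neighbours on it.
    Extending the path greedily inside sets of large minimum degree turns this
    into a statement about such sets: they are completely joined
    ([saturated_join]).  Now delete vertices of degree at most h from G' as long
    as possible.  If nothing remains, G has at most h(h-1)/2 + h(n-h) = e(G_1)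
    edges, where e(G_1) <= f(n,k,r) for even k.  Otherwise a clique C of G' with
    s vertices remains, h+2 <= s < k, and the same C remains when only vertices
    of degree at most k-s are deleted.  Here C spans at most t(s) edges of G, so
    e(G) <= t(s) + (k-s)(n-s), which is at most f(n,k,r) ([block_numeric]).

    The theorem on paths rests on two disjoint paths found by augmentation
    ([linkage_step]) which are closed up to a cycle through all neighbours of
    both end vertices ([fan_arc]).

    Graphs are symmetric irreflexive relations on a finite type, and edges are
    counted twice, as ordered pairs, so that no division by 2 occurs. *)

Set Implicit Arguments.
Unset Strict Implicit.
Unset Printing Implicit Defensive.

(** * Two disjoint paths in a 2-connected graph *)

(** Cycles are duplicate-free cyclic sequences, among them loops and edges
    run back and forth; these are too short to matter once [2 < k]. *)
Definition no_cycle_ge (V : finType) (k : nat) (e : rel V) : Prop :=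
  forall c : seq V, cycle e c -> uniq c -> size c < k.

(** Deleting any vertex [z] leaves a connected graph.  With at least three
    vertices the graph itself is then connected as well. *)
Definition two_connected (V : finType) (e : rel V) : Prop :=
  forall z x y : V, x != z -> y != z ->
    connect (fun a b => [&& e a b, a != z & b != z]) x y.

Section Linkage.
Variables (V : finType) (e : rel V).
Hypothesis sym_e : symmetric e.

Lemma path_revE x p : path e (last x p) (rev (belast x p)) = path e x p.
Proof. by rewrite rev_path; apply: eq_path => a b; rewrite sym_e. Qed.

Lemma last_rev_belast (x : V) p : last (last x p) (rev (belast x p)) = x.
Proof.
case: p => //= y p; rewrite rev_cons last_rcons //.
Qed.

Lemma closed_path_cycle x p : path e x p -> last x p = x -> cycle e p.
Proof. by move=> ep lp; rewrite (cycle_path x) lp. Qed.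

(** A path from [X] to [Y] is cut at its last visit to [X], and then at the
    first visit to [Y] after that. *)
Lemma bridge_path (X Y : {set V}) x p :
  x \in X -> path e x p -> uniq (x :: p) -> last x p \in Y -> [disjoint X & Y] ->
  exists z q, [/\ z \in X, path e z q, uniq (z :: q), last z q \in Y &
    [/\ {in belast z q, forall a, a \notin Y}, {in q, forall a, a \notin X}
      & {subset q <= p}]].
Proof.
move=> xX ep up lp dXY.
elim: {p}_.+1 {-2}p (ltnSn (size p)) x xX ep up lp => // n IH p sp x xX ep up lp.
have [/hasP[z zp zX]|nX] := boolP (has (mem X) p).
  case/splitPr: zp sp ep up lp => p1 p2; rewrite size_cat /= => sp.
  rewrite cat_path /= => /and3P[_ _ ep2]; rewrite last_cat /= => up lp.
  have up2 : uniq (z :: p2).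
    by move: up => /andP[_]; rewrite cat_uniq => /and3P[].
  have [|z' [q [h1 h2 h3 h4 [h5 h6 h7]]]] := IH p2 _ z zX ep2 up2 lp.
    by move: sp; lia.
  exists z', q; split=> //; split=> // a /h7 ap.
  by rewrite mem_cat inE ap !orbT.
have [/hasP[z zp zY]|nY] := boolP (has (mem Y) (belast x p)).
  have zx : z != x.
    by apply: contraTneq zY => -> /=; rewrite (disjointFr dXY xX).
  have zp' : z \in p.
    have := mem_belast zp; rewrite inE (negPf zx) //.
  case/splitPr: zp' zp nX sp ep up lp => p1 p2 zp nX sp ep up lp.
  have p2n : 0 < size p2.
    case: (p2) zp up {nX sp ep lp} => //; rewrite cats1 belast_rcons => zp.
    by rewrite -rcons_cons rcons_uniq zp.
  have [||||z' [q [h1 h2 h3 h4 [h5 h6 h7]]]] := IH (rcons p1 z) _ x xX.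
  - move: sp; rewrite size_rcons size_cat /= addnS ltnS => sp.
    by apply: leq_ltn_trans sp; rewrite -addn1 leq_add2l.
  - by move: ep; rewrite -cat_rcons cat_path => /andP[].
  - by move: up; rewrite -cat_rcons -cat_cons cat_uniq => /and3P[].
  - by rewrite last_rcons.
  exists z', q; split=> //; split=> // a /h7 ap.
  by rewrite -cat_rcons mem_cat ap.
exists x, p; split=> //; split=> // a.
  by move=> ap; move/hasPn/(_ a ap): nY.
by move=> ap; move/hasPn/(_ a ap): nX.
Qed.

Hypothesis two_e : two_connected e.

Lemma bridge (X Y : {set V}) b :
  X != set0 -> Y != set0 -> b \notin X -> b \notin Y -> [disjoint X & Y] ->
  exists z q, [/\ z \in X, path e z q, uniq (z :: q), last z q \in Y &
    [/\ {in belast z q, forall a, a \notin Y}, {in q, forall a, a \notin X}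
      & b \notin q]].
Proof.
case/set0Pn=> x xX /set0Pn[y yY] bX bY dXY.
have xb : x != b by apply: contraNneq bX => <-.
have yb : y != b by apply: contraNneq bY => <-.
have /connectP[p0 ep0 lp0] := two_e xb yb.
case/shortenP: ep0 lp0 => p ep up _ lp.
have bp : b \notin p.
  apply/negP => /(nthP b)[i si nb].
  by have /(pathP b)/(_ i si)/and3P[_ _] := ep; rewrite nb eqxx.
have ep' : path e x p by apply: sub_path ep => a c /and3P[].
have [|z [q [h1 h2 h3 h4 [h5 h6 h7]]]] := @bridge_path X Y x p xX ep' up _ dXY.
  by rewrite -lp.
by exists z, q; split=> //; split=> //; apply: contra bp => /h7.
Qed.

(** One of the two paths of a linkage: it leaves the root set [A] for good at
    its first vertex [l]. *)
Definition leg (A : {set V}) (l : V) (L : seq V) : Prop :=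
  [/\ path e l L, uniq (l :: L), l \in A & {in L, forall a, a \notin A}].

Lemma leg_take A l L1 L2 : leg A l (L1 ++ L2) -> leg A l L1.
Proof.
case; rewrite cat_path -cat_cons cat_uniq => /andP[eL _] /and3P[uL _ _] lA LA.
by split=> // a aL; apply: LA; rewrite mem_cat aL.
Qed.

Lemma leg_cat A l L q :
  leg A l L -> path e (last l L) q -> uniq q ->
  {in q, forall a, a \notin A} -> {in q, forall a, a \notin l :: L} ->
  leg A l (L ++ q).
Proof.
case=> eL uL lA LA eq uq qA qL; split=> //.
- by rewrite cat_path eL.
- by rewrite -cat_cons cat_uniq uL uq andbT; apply/hasPn.
- by move=> a; rewrite mem_cat => /orP[/LA|/qA].
Qed.

(** Two disjoint paths out of [A]: one to the target vertex [b], one to the set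
    [T] that lies beyond [b].  Exactly one of them starts at the prescribed
    vertex [a0].  Menger's theorem alone does not prescribe [a0]; keeping it
    under augmentation is what later lets the cycle pick up all neighbours
    inside [A]. *)
Definition linkage (A : {set V}) (a0 b : V) (T : {set V}) : Prop :=
  exists l L m M,
    [/\ [/\ leg A l L, leg A m M & {in l :: L, forall a, a \notin m :: M}],
        (l == a0) (+) (m == a0),
        last l L = b, last m M \in T &
        {in L, forall a, a \notin T} /\ {in belast m M, forall a, a \notin T}].

(** The first path is the single vertex [a0], the second one exists because
    deleting [a0] does not disconnect the graph. *)
Lemma linkage_start (A T : {set V}) a0 :
  a0 \in A -> A :\ a0 != set0 -> T != set0 -> [disjoint A & T] ->
  linkage A a0 a0 T.
Proof.
move=> a0A A0 T0 dAT.
have [|||z [q [zA ez uz lz [h5 h6 h7]]]] := @bridge (A :\ a0) T a0 A0 T0.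
- by rewrite !inE eqxx.
- by rewrite (disjointFr dAT a0A).
- by apply: disjointWl dAT; apply: subsetDl.
have /andP[za zA'] : (z != a0) && (z \in A) by move: zA; rewrite !inE.
exists a0, [::], z, q; split=> //=.
- split=> //.
  + split=> // a aq; have := h6 a aq; rewrite !inE; case: eqP => //= aa0.
    by rewrite -aa0 aq in h7.
  + by move=> a; rewrite inE => /eqP ->; rewrite inE negb_or eq_sym za.
- by rewrite eqxx (negPf za).
Qed.

(** The augmentation step, advancing the target from [b] to its neighbour [b']
    in [T].  If the second path does not end at [b'], the edge from [b] to [b']
    prolongs the first one.  If it does, deleting [b'] leaves a bridge from [A]
    and the two paths to the rest of [T].  Wherever the bridge starts, it can
    replace the tail of one of the paths, or a whole path that does not start
    at [a0], and what is left still reaches [b']. *)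
Lemma linkage_step (A T : {set V}) a0 b b' :
  [disjoint A & T] -> a0 \in A -> b' \in T -> T :\ b' != set0 -> e b b' ->
  linkage A a0 b T -> linkage A a0 b' (T :\ b').
Proof.
move=> dAT a0A b'T T0 ebb'.
move=> [l [L [m [M [[gL gM dLM] hx Lb Mw [LT MT]]]]]].
have b'A : b' \notin A by rewrite (disjointFl dAT b'T).
have AT a : a \in A -> a \notin T by move=> aA; rewrite (disjointFr dAT aA).
have [_ _ lA LA] := gL; have [_ _ mA MA] := gM.
have b'L : b' \notin l :: L.
  rewrite inE negb_or; apply/andP; split.
    by apply: contraNneq b'A => ->.
  by apply/negP => /LT; rewrite b'T.
have gLb : leg A l (L ++ [:: b']).
  apply: leg_cat => //=; rewrite ?Lb ?ebb' // => a; rewrite inE => /eqP -> //.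
have T'T a : a \notin T -> a \notin T :\ b'.
  by move=> aT; rewrite !inE (negPf aT) andbF.
have LbT : {in L ++ [:: b'], forall a, a \notin T :\ b'}.
  move=> a; rewrite mem_cat mem_seq1 => /orP[/LT/T'T //|/eqP->].
  by rewrite !inE eqxx.
have [wb|wb] := eqVneq (last m M) b'; last first.
  exists l, (L ++ [:: b']), m, M; split=> //.
  - split=> // a; rewrite -cat_cons mem_cat mem_seq1 => /orP[/dLM //|/eqP->].
    rewrite lastI mem_rcons inE eq_sym (negPf wb) /=.
    by apply/negP => /MT; rewrite b'T.
  - by rewrite last_cat.
  - by rewrite !inE wb Mw.
  - by split=> // a /MT/T'T.
pose X := (A :|: [set a in L] :|: [set a in M]) :\ b'.
have lX : l \in X.
  by rewrite !inE lA /= andbT; apply: contraNneq b'A => <-.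
have AT' a : a \in A -> a \notin T :\ b' by move=> /AT/T'T.
have LT' a : a \in L -> a \notin T :\ b' by move=> /LT/T'T.
have MT' a : a \in M -> a \notin T :\ b'.
  move=> aM; have : a \in m :: M by rewrite inE aM orbT.
  rewrite lastI mem_rcons inE wb => /orP[/eqP->|/MT/T'T //].
  by rewrite !inE eqxx.
have [||||z [q [zX eq uq lq [h5 h6 h7]]]] := @bridge X (T :\ b') b' _ T0.
- by apply/set0Pn; exists l.
- by rewrite !inE eqxx.
- by rewrite !inE eqxx.
- apply/pred0Pn => -[a /andP[/= aX aT]].
  move: aX; rewrite !inE => /andP[_ /orP[/orP[/AT'|/LT']|/MT']]; by rewrite aT.
have qX a : a \in q -> [/\ a \notin A, a \notin l :: L & a \notin m :: M].
  move=> aq; have := h6 a aq; rewrite !inE.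
  have -> : a != b' by apply: contraNneq h7 => <-.
  rewrite /= !negb_or => /andP[/andP[aA -> ->]]; split=> //; rewrite andbT.
    by apply: contraNneq aA => ->.
  by apply: contraNneq aA => ->.
have zb' : z != b' by move: zX; rewrite !inE => /andP[].
have uq' : uniq q by case/andP: uq.
have extend l' L1 L2 : leg A l' (L1 ++ L2) -> last l' L1 = z ->
    {in L1 ++ L2, forall a, a \notin T :\ b'} ->
    {in q, forall a, a \notin l' :: (L1 ++ L2)} ->
    [/\ leg A l' (L1 ++ q), last l' (L1 ++ q) \in T :\ b' &
     {in belast l' (L1 ++ q), forall a, a \notin T :\ b'}].
  move=> g lz nT nq; have g1 := leg_take g; have [_ _ l'A _] := g.
  split.
  - apply: leg_cat => //; first by rewrite lz.
      by move=> a /qX[].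
    by move=> a /nq; rewrite -cat_cons mem_cat negb_or => /andP[].
  - by rewrite last_cat lz.
  - move=> a; rewrite belast_cat lz mem_cat => /orP[aL|/h5 //].
    have := mem_belast aL; rewrite inE => /orP[/eqP->|aL1]; first exact: AT'.
    by apply: nT; rewrite mem_cat aL1.
(* A bridge from the first path turns it into the path to T; the second one
   already ends at b'. *)
have [zL|zL] := boolP (z \in l :: L).
  case/splitPl: zL gL dLM LT' qX {gLb LbT b'L Lb LT X h6 lX zX LA} =>
    L1 L2 zL gL dLM LT' qX.
  have [||g1 g2 g3] := extend l L1 L2 gL zL; first by move=> a /LT'.
    by move=> a /qX[].
  exists m, M, l, (L1 ++ q); split=> //.
  - split=> // a am; rewrite -cat_cons mem_cat negb_or.
    apply/andP; split; last by apply: contraL am => /qX[].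
    apply: contraL am => al; apply: dLM.
    by rewrite -cat_cons mem_cat al.
  - by rewrite addbC.
(* A bridge from the second path replaces its tail; the first one is prolonged
   to b'. *)
have [zM|zM] := boolP (z \in m :: M).
  case/splitPl: zM gM dLM MT' qX wb {h6 MT Mw MA zX X lX} =>
    M1 M2 zM gM dLM MT' qX wb.
  have [||g1 g2 g3] := extend m M1 M2 gM zM; first by move=> a /MT'.
    by move=> a /qX[].
  exists l, (L ++ [:: b']), m, (M1 ++ q); split=> //; last by rewrite last_cat.
  have b'M1 : b' \notin m :: M1.
    have [_ + _ _] := gM; rewrite -cat_cons cat_uniq => /and3P[_ /hasPn nM _].
    have := wb; rewrite last_cat zM.
    case: (M2) nM => [|a M2'] nM /= lb; first by rewrite lb eqxx in zb'.
    by apply: nM; rewrite -lb mem_last.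
  split=> // a; rewrite -cat_cons mem_cat mem_seq1 => /orP[al|/eqP->].
    rewrite -cat_cons mem_cat negb_or; apply/andP; split.
      by have := dLM a al; rewrite -cat_cons mem_cat negb_or => /andP[].
    by apply: contraL al => /qX[].
  by rewrite -cat_cons mem_cat negb_or b'M1 h7.
(* A bridge from A off both paths replaces the one that does not start at a0. *)
have zA : z \in A.
  move: zX zL zM; rewrite !inE !negb_or.
  by case/andP=> _ /orP[/orP[//|->]|->]; rewrite ?andbF.
have za0 : z != a0.
  apply: contraTneq hx => za; move: zL zM; rewrite za !inE !negb_or.
  by rewrite ![a0 == _]eq_sym => /andP[/negPf-> _] /andP[/negPf-> _].
have [||||gz lzq bzq] := extend z [::] [::] => //.
  by move=> a aq; rewrite inE; apply: contraTneq aq => ->; case/andP: uq.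
rewrite /= in gz lzq bzq.
have [lq0|lq0] := eqVneq l a0.
  exists l, (L ++ [:: b']), z, q; split=> //; last by rewrite last_cat.
    split=> // a; rewrite -cat_cons mem_cat mem_seq1 => /orP[al|/eqP->].
      rewrite inE negb_or; apply/andP; split.
        by apply: contraNneq zL => <-.
      by apply: contraL al => /qX[].
    by rewrite inE negb_or eq_sym zb' h7.
  by rewrite lq0 eqxx (negPf za0).
have mq0 : m == a0 by move: hx; rewrite (negPf lq0).
exists m, M, z, q; split=> //.
  split=> // a am; rewrite inE negb_or; apply/andP; split.
    by apply: contraNneq zM => <-.
  by apply: contraL am => /qX[].
by rewrite mq0 (negPf za0).
Qed.

(** * Neighbours of the end vertices of a path *)

Lemma rev_path_ends x p : path e x p -> uniq (x :: p) ->
  exists q, [/\ path e (last x p) q, last (last x p) q = x,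
                uniq (last x p :: q) & last x p :: q =i x :: p].
Proof.
move=> ep up; exists (rev (belast x p)).
have E : last x p :: rev (belast x p) = rev (x :: p).
  by rewrite [in RHS]lastI rev_rcons.
split; first by rewrite path_revE.
- exact: last_rev_belast.
- by rewrite E rev_uniq.
- by move=> z; rewrite E mem_rev.
Qed.

(** Running from [u] back to [x] and jumping from there along the first edge
    that lands beyond [u] skips no neighbour of [x]: the vertices left out lie
    strictly between [u] and the landing point. *)
Lemma fan_arc x q u :
  path e x q -> uniq (x :: q) -> e x (last x q) -> u \in x :: q ->
  u != last x q ->
  exists Q, [/\ path e u Q, last u Q = last x q, uniq (u :: Q),
    {subset u :: Q <= x :: q} &
    {in x :: q, forall z, (z == x) || e x z -> z \in u :: Q}].
Proof.
move=> eq uq exl uin; case/splitPl: uin eq uq exl => p1 p2 lu eq uq exl.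
rewrite last_cat lu; have [v lv] : exists v, last u p2 = v by exists (last u p2).
rewrite lv => uv; rewrite last_cat lu lv in exl.
have hp2 : has (e x) p2.
  apply/hasP; exists v => //.
  case: (p2) uv lv => [|b p3] /= uv lv; last by rewrite -lv mem_last.
  by rewrite lv eqxx in uv.
case/split_find: hp2 lv eq uq => a q1 q2 exa nq1.
rewrite cat_path lu -cat_cons => lv /andP[ep1 ep2] uq.
have E : u :: rev (belast x p1) = rev (x :: p1).
  by rewrite [in RHS]lastI rev_rcons lu.
have S : subseq ((x :: p1) ++ a :: q2) ((x :: p1) ++ (rcons q1 a ++ q2)).
  by rewrite cat_subseq // cat_rcons suffix_subseq.
exists (rev (belast x p1) ++ a :: q2); split.
- rewrite cat_path -lu path_revE ep1 last_rev_belast /= exa /=.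
  by move: ep2; rewrite cat_path last_rcons => /andP[].
- by rewrite last_cat /= -lv last_cat last_rcons.
- rewrite -cat_cons E (@perm_uniq _ _ ((x :: p1) ++ a :: q2)).
    exact: subseq_uniq S uq.
  by rewrite perm_cat2r perm_rev.
- move=> z; rewrite -!cat_cons E mem_cat mem_rev -mem_cat.
  exact: mem_subseq S z.
- move=> z; rewrite -!cat_cons E !mem_cat mem_rev mem_rcons.
  case/orP=> [->//|]; case/orP=> [|zq2]; last by rewrite [z \in a :: _]inE zq2 !orbT.
  rewrite inE => /orP[/eqP->|zq1]; first by rewrite mem_head orbT.
  by case/orP=> [/eqP->|exz]; [rewrite mem_head | case/hasP: nq1; exists z].
Qed.

Lemma last_take_nth (x : V) p i :
  i < size (x :: p) -> last x (take i p) = nth x (x :: p) i.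
Proof.
move=> /= ip; rewrite (last_nth x) size_takel //.
by rewrite -[x :: take i p]/(take i.+1 (x :: p)) nth_take.
Qed.

Lemma drop_path x p i : i < size (x :: p) -> path e x p ->
  path e (nth x (x :: p) i) (drop i p).
Proof.
by move=> ip; rewrite -[p in path e x p](cat_take_drop i) cat_path
  last_take_nth // => /andP[].
Qed.

Lemma last_drop_nth (x : V) p i : i < size (x :: p) ->
  last (nth x (x :: p) i) (drop i p) = last x p.
Proof.
by move=> ip; rewrite -[p in RHS](cat_take_drop i) last_cat last_take_nth.
Qed.

Lemma card_nth_filter (P : pred V) (x0 : V) (s : seq V) : uniq s ->
  #|[set z in s | P z]| = size [seq i <- iota 0 (size s) | P (nth x0 s i)].
Proof.
move=> us; transitivity (size (filter P s)).
  rewrite -(card_uniqP (filter_uniq P us)); apply: eq_card => z.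
  by rewrite inE mem_filter andbC.
by rewrite -[s in filter P s](mkseq_nth x0) /mkseq filter_map size_map.
Qed.

(** The neighbours of [x] and [y] cross: position [i] is adjacent to [y], and
    the later position [i + d] to [x].  The path, cut between the two and closed
    up by these edges, is a cycle missing only the [d - 1] positions between.
    For minimal [d] no neighbour of [x] or [y] is missed, and the positions of
    neighbours of [x] are disjoint from those of neighbours of [y] shifted by
    one, since a coincidence would be a crossing with [d = 1].  So the two
    degrees add up to at most the length of this cycle. *)
Lemma crossing_bound k x p i d :
  let s := x :: p in let y := last x p in
  irreflexive e -> no_cycle_ge k e -> path e x p -> uniq s -> k <= size s ->
  0 < d -> i + d < size s -> e x (nth x s (i + d)) -> e y (nth x s i) ->
  (forall i' d', 0 < d' -> i' + d' < size s -> e x (nth x s (i' + d')) ->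
     e y (nth x s i') -> d <= d') ->
  #|[set z in s | e x z]| + #|[set z in s | e y z]| < k.
Proof.
move=> s y irr nc ep us ks d0 ids exj eyi dmin.
have i_lt : i < size s by lia.
pose j := i + d; have jE : j = i + d by [].
(* Up to position i, over to y, back along the path to position j, over to x. *)
pose c := take i.+1 s ++ rev (drop j s).
have drE : drop j s = nth x s j :: drop j p by rewrite (drop_nth x).
have lastd : last (nth x s j) (drop j p) = y := last_drop_nth ids.
have szc : size c = i.+1 + (size s - j).
  by rewrite size_cat size_takel // size_rev size_drop.
have : cycle e c.
  rewrite /c /= rcons_cat cat_path take_path //= last_take_nth //.
  rewrite -/s drE lastI lastd rev_rcons /= sym_e eyi /=.
  rewrite rcons_path -lastd path_revE [path _ _ _]drop_path //=.
  by rewrite last_rev_belast sym_e.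
move/nc; rewrite szc => {}nc.
have uc : uniq c.
  rewrite cat_uniq take_uniq // rev_uniq drop_uniq // andbT.
  apply/hasPn => z; rewrite mem_rev => zd.
  have : uniq (take i.+1 s ++ drop i.+1 s) by rewrite cat_take_drop.
  rewrite cat_uniq => /and3P[_ /hasPn nz _]; apply: nz.
  by move: zd; rewrite -(subnK (_ : i.+1 <= j)) -?drop_drop; [move/mem_drop|lia].
have {nc uc} nc := nc uc.
apply: (leq_ltn_trans _ nc).
rewrite !(@card_nth_filter _ x) //.
set IA := [seq _ <- _ | _]; set IB := [seq _ <- _ | _].
have d2 : 1 < d by lia.
rewrite -(size_map S IB) -size_cat -(size_iota 1 i.+1) -(size_iota j (size s - j)).
rewrite -size_cat; apply: uniq_leq_size.
  have uA : uniq IA by apply: filter_uniq; exact: iota_uniq.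
  have uB : uniq IB by apply: filter_uniq; exact: iota_uniq.
  rewrite cat_uniq uA (map_inj_uniq succn_inj) uB andbT /=.
  apply/hasPn => _ /mapP[b + ->]; rewrite mem_filter mem_iota => /andP[eyb bs].
  apply/negP.
  rewrite mem_filter mem_iota => /andP[exb bs'].
  have b1 : b + 1 < size s by lia.
  by have := dmin b 1 isT b1; rewrite addn1 => /(_ exb eyb); lia.
move=> a; rewrite !mem_cat !mem_iota => /orP[|/mapP[b]].
  rewrite mem_filter mem_iota => /andP[exa as'].
  case: a exa as' => [|a] exa as'; first by rewrite /= irr in exa.
  have [h|h] := leqP a.+1 i; first by lia.
  have [h'|h'] := leqP j a.+1; first by lia.
  have d1 : 0 < a.+1 - i by lia.
  have d3 : i + (a.+1 - i) = a.+1 by lia.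
  have d4 : a.+1 < size s by lia.
  by have := dmin i _ d1; rewrite d3 => /(_ d4 exa eyi); lia.
rewrite mem_filter mem_iota => /andP[eyb bs] ->.
have bm : b != size p.
  apply: contraTneq eyb => ->; rewrite nth_last /= irr //.
have [h|h] := leqP b i; first by lia.
have [h'|h'] := leqP j b; first by move: bs bm; rewrite /s /=; lia.
have d1 : 0 < j - b by lia.
have d3 : b + (j - b) = j by lia.
by have := dmin b _ d1; rewrite d3 => /(_ ids exj eyb); lia.
Qed.

(** Augmentation, repeated along the segment of the path from position [i] to
    position [i + t], with the part up to position [i] as root set. *)
Lemma linkage_along x p i t :
  path e x p -> uniq (x :: p) -> 0 < i -> i + t < size p ->
  linkage [set z in take i.+1 (x :: p)] (nth x (x :: p) i)
    (nth x (x :: p) (i + t)) [set z in drop (i + t) p].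
Proof.
move=> ep us i0 itp.
have us' : uniq (take i.+1 (x :: p) ++ drop i p) by rewrite /= cat_take_drop; exact: us.
have dA u : i <= u -> [disjoint [set z in take i.+1 (x :: p)] & [set z in drop u p]].
  move=> iu; apply/pred0Pn => -[z /andP[/=]]; rewrite !inE => zA.
  rewrite -(subnK iu) -drop_drop => /mem_drop zd.
  move: us'; rewrite cat_uniq => /and3P[_ /hasPn/(_ z zd) + _].
  by rewrite /= inE zA.
have a0A : nth x (x :: p) i \in [set z in take i.+1 (x :: p)].
  rewrite inE -(@nth_take i.+1) //; apply: mem_nth.
  by rewrite size_takel //=; lia.
have dE u : u < size p -> drop u p = nth x p u :: drop u.+1 p.
  by move=> up; rewrite (drop_nth x).
have T0 u : u < size p -> [set z in drop u p] != set0.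
  by move=> up; apply/set0Pn; exists (nth x p u); rewrite inE dE // mem_head.
elim: t itp => [|t IH] itp.
  rewrite addn0 in itp *; apply: linkage_start => //; [|exact: T0|exact: dA].
  apply/set0Pn; exists x; rewrite !inE eqxx /= andbT.
  have -> : nth x (x :: p) i = nth x p i.-1 by case: (i) i0.
  apply: contraTneq us => xE; rewrite /= {1}xE mem_nth //.
  exact: leq_ltn_trans (leq_pred _) itp.
have itp' : i + t < size p by lia.
have {}IH := IH itp'.
have E : [set z in drop (i + t.+1) p] =
         [set z in drop (i + t) p] :\ nth x (x :: p) (i + t.+1).
  apply/setP => z; rewrite addnS !inE [in RHS]dE // inE /=.
  have : uniq (drop (i + t) p) by apply: drop_uniq; case/andP: us.
  rewrite dE // /= => /andP[n _]; case: eqP => // ->.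
  by rewrite (negPf n).
rewrite E; apply: linkage_step IH => //.
- exact/dA/leq_addr.
- by rewrite inE addnS dE // mem_head.
- by rewrite -E; apply: T0.
- by rewrite addnS /=; apply/(pathP x).
Qed.

(** Kopylov's lemma on long paths.  If the neighbours of [x] and [y] do not
    cross, those of [x] end at a position [i] not after the position [j] where
    those of [y] begin.  A linkage from the part up to [i] to the part from [j]
    on closes up to a cycle through [x], [y] and all their neighbours on the
    path, and at most one vertex is counted for both, namely when [i = j]. *)
Lemma path_degree_sum k x p :
  irreflexive e -> no_cycle_ge k e -> path e x p -> uniq (x :: p) ->
  k <= size (x :: p) -> 0 < size p ->
  #|[set z in x :: p | e x z]| + #|[set z in x :: p | e (last x p) z]| < k.
Proof.
move=> irr nc ep us ks p0; set s := x :: p; set y := last x p.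
pose cr d := [exists i : 'I_(size s), [&& 0 < d, i + d < size s,
  e x (nth x s (i + d)) & e y (nth x s i)]].
have crI i d : 0 < d -> i + d < size s -> e x (nth x s (i + d)) ->
    e y (nth x s i) -> cr d.
  move=> d0 ids h1 h2; have si : i < size s by lia.
  by apply/existsP; exists (Ordinal si); apply/and4P.
have [[d crd]|ncr] := boolp.pselect (exists d, cr d).
  have [d' /existsP[i /and4P[d0 ids h1 h2]] dmin] := ex_minnP (ex_intro _ d crd).
  apply: (@crossing_bound k x p i d') => // i' d'' h3 h4 h5 h6.
  exact/dmin/(crI i').
have exx : exists a, (a < size s) && e x (nth x s a).
  exists 1; case: (p) p0 ep @s {y cr crI ncr us ks} => //= b q _ /andP[-> _] //.
have exy : exists a, (a < size s) && e y (nth x s a).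
  exists (size p).-1; apply/andP; split; first by rewrite /s /=; lia.
  rewrite sym_e /y -(nth_last x) /s.
  by apply: (pathP x ep); lia.
have ubx a : (a < size s) && e x (nth x s a) -> a <= size s by case/andP=> /ltnW.
have [i /andP[is_ exi] imax] := ex_maxnP exx ubx.
have [j /andP[js eyj] jmin] := ex_minnP exy.
have ij : i <= j.
  rewrite leqNgt; apply/negP => ji; apply: ncr; exists (i - j).
  by apply: (crI j) => //; rewrite ?subnKC //; lia.
have i0 : 0 < i.
  by case: i exi {is_ imax ij} => //=; rewrite irr.
have jp : j < size p.
  rewrite ltn_neqAle -ltnS js andbT; apply: contraTneq eyj => ->.
  by rewrite -/(size p).+1.-1 nth_last /= irr.
have L0 := @linkage_along x p i (j - i) ep us i0.
rewrite subnKC // -/s in L0; have {L0} := L0 jp.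
set A := [set z in take i.+1 s]; set T := [set z in drop j p].
set a0 := nth x s i; set b := nth x s j.
move=> [l [L [m [M [[[eL uL lA LA] [eM uM mA MA] dLM] hx Lb Mw [LT MT]]]]]].
have dAT : {in A, forall z, z \notin T}.
  move=> z; rewrite !in_set => zA; apply/negP => zT.
  have : uniq (take j.+1 s ++ drop j p) by rewrite /= cat_take_drop; exact: us.
  rewrite cat_uniq => /and3P[_ /hasPn/(_ z zT) + _] => /negP; apply.
  by move: zA; rewrite -(@take_takel _ i.+1 j.+1) // => /mem_take.
have bT : b \notin T.
  have : uniq (drop j s) by apply: drop_uniq.
  by rewrite inE (drop_nth x js) /= => /andP[].
have isz : i < size s by [].
have la0 : last x (take i p) = a0 by apply: last_take_nth.
(* One of the two feet l, m of the linkage is a0, the last neighbour of x on the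
   path, as fan_arc requires. *)
have [QA [eQA lQA uQA sQA cQA]] : exists Q, [/\ path e l Q, last l Q = m,
    uniq (l :: Q), {subset l :: Q <= A} &
    {in A, forall z, (z == x) || e x z -> z \in l :: Q}].
  have epA : path e x (take i p) by apply: take_path.
  have upA : uniq (x :: take i p) by apply: (take_uniq i.+1 us).
  have exa0 : e x (last x (take i p)) by rewrite la0.
  have [la|la] := eqVneq l a0.
    have ma : m != last x (take i p) by move: hx; rewrite la0 la eqxx; case: eqP.
    have mA' : m \in x :: take i p by move: mA; rewrite in_set.
    have [Q [h1 h2 h3 h4 h5]] := fan_arc epA upA exa0 mA' ma.
    have [R [k1 k2 k3 k4]] := rev_path_ends h1 h3.
    rewrite h2 la0 -la in k1 k2 k3 k4; exists R; split=> // z.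
      by rewrite k4 in_set; exact: h4.
    by rewrite k4 in_set; exact: h5.
  have la' : l != last x (take i p) by rewrite la0.
  have lA' : l \in x :: take i p by move: lA; rewrite in_set.
  have [Q [h1 h2 h3 h4 h5]] := fan_arc epA upA exa0 lA' la'.
  have ma : m = a0 by move: hx; rewrite (negPf la) => /eqP.
  exists Q; split=> //; first by rewrite h2 la0 ma.
    by move=> z; rewrite in_set; exact: h4.
  by move=> z; rewrite in_set; exact: h5.
set w := last m M in Mw.
have wb : w != b by apply: contraNneq bT => <-.
(* The same at the other end of the path, read backwards. *)
have [QB [eQB lQB uQB sQB cQB]] : exists Q, [/\ path e w Q, last w Q = b,
    uniq (w :: Q), {subset w :: Q <= b :: drop j p} &
    {in b :: drop j p, forall z, (z == y) || e y z -> z \in w :: Q}].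
  have edp : path e b (drop j p) by apply: drop_path.
  have udp : uniq (b :: drop j p).
    have : uniq (drop j s) by apply: drop_uniq.
    by rewrite (drop_nth x js).
  have ldp : last b (drop j p) = y by apply: last_drop_nth.
  have [q [k1 k2 k3 k4]] := rev_path_ends edp udp.
  rewrite ldp in k1 k2 k3 k4.
  have [|||Q [h1 h2 h3 h4 h5]] := fan_arc (u := w) k1 k3.
  - by rewrite k2.
  - by rewrite k4 inE; move: Mw; rewrite inE => ->; rewrite orbT.
  - by rewrite k2.
  rewrite k2 in h2.
  exists Q; split=> // z; first by move/h4; rewrite k4.
  by rewrite -k4; apply: h5.
(* The cycle starts after l and ends in l. For i = j the list L is empty, and
   then b = l is reached at the end of QB. *)
pose c := QA ++ M ++ QB ++ rev (belast l L).
have lc : last l c = l.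
  by rewrite /c !last_cat lQA -/w lQB -Lb last_rev_belast.
have cc : cycle e c.
  apply: (closed_path_cycle (x := l)) => //.
  rewrite /c !cat_path lQA -/w lQB -Lb path_revE.
  by apply/and4P.
have QAA z : z \in QA -> z \in A /\ z != l.
  move=> zQ; split; first by apply: sQA; rewrite inE zQ orbT.
  by apply: contraTneq zQ => ->; case/andP: uQA.
have QBB z : z \in QB -> ((z == b) || (z \in T)) /\ z != w.
  move=> zQ; split.
    have /sQB : z \in w :: QB by rewrite inE zQ orbT.
    by rewrite !inE.
  by apply: contraTneq zQ => ->; case/andP: uQB.
have belL z : z \in belast l L -> [/\ z \in l :: L, z != b & z \notin T].
  move=> zL; have zl := mem_belast zL; split=> //.
    apply: contraTneq zL => ->; move: uL; rewrite lastI rcons_uniq -Lb.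
    by case/andP.
  by move: zl; rewrite inE => /orP[/eqP->|/LT //]; apply: dAT.
have bA : b \in A -> b = l.
  move=> bA; have : b \in l :: L by rewrite -Lb mem_last.
  by rewrite inE => /orP[/eqP //|/LA]; rewrite bA.
have bLl : b \in l :: L by rewrite -Lb mem_last.
have uc : uniq c.
  have uQA' : uniq QA by case/andP: uQA.
  have uQB' : uniq QB by case/andP: uQB.
  have uM' : uniq M by case/andP: uM.
  have uL' : uniq (rev (belast l L)).
    by rewrite rev_uniq; move: uL; rewrite lastI rcons_uniq => /andP[].
  rewrite /c cat_uniq uQA' cat_uniq uM' cat_uniq uQB' uL' andbT /=.
  apply/and3P; split; apply/hasPn => z; rewrite ?mem_cat ?mem_rev.
  - case/or3P=> [zM|/QBB[zB zw]|/belL[zL zb zT]]; apply/negP => /QAA[zA zl].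
    + by have := MA z zM; rewrite zA.
    + case/orP: zB => [/eqP zb|zT]; last by have := dAT z zA; rewrite zT.
      by rewrite zb in zl zA; rewrite (bA zA) eqxx in zl.
    + move: zL; rewrite inE (negPf zl) => /LA.
      by rewrite zA.
  - case/orP=> [/QBB[zB zw]|/belL[zL zb zT]]; apply/negP => zM.
    + case/orP: zB => [/eqP zb|zT].
        by have := dLM b bLl; rewrite -zb inE zM orbT.
      have : z \in m :: M by rewrite inE zM orbT.
      rewrite lastI mem_rcons inE (negPf zw) => /MT; by rewrite zT.
    + by have := dLM z zL; rewrite inE zM orbT.
  - move=> /belL[zL zb zT]; apply/negP => /QBB[].
    by rewrite (negPf zb) (negPf zT).
have lQ : l \in QA ++ M ++ QB ++ rev (belast l L).
  rewrite -/c -[X in X \in _]lc; case E: c => [|z c' /=]; last exact: mem_last.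
  move: E hx; rewrite /c; case: (QA) lQA => //= <- _; by rewrite addbb.
have wM : w \in M.
  have : w \in m :: M by apply: mem_last.
  by rewrite inE => /orP[/eqP wm|//]; have := dAT m mA; rewrite -wm Mw.
have Ac z : z \in A -> (z == x) || e x z -> z \in c.
  move=> zA /(cQA z zA); rewrite inE => /orP[/eqP->|zQ] //.
  by rewrite /c mem_cat zQ.
have Bc z : z \in b :: drop j p -> (z == y) || e y z -> z \in c.
  move=> zB /(cQB z zB); rewrite inE /c !mem_cat => /orP[/eqP->|->].
    by rewrite wM orbT.
  by rewrite !orbT.
have NxA z : z \in s -> (z == x) || e x z -> z \in A.
  move=> zs /orP[/eqP->|exz]; first by rewrite inE mem_head.
  have zi : index z s <= i by apply: imax; rewrite index_mem zs nth_index.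
  rewrite inE -(nth_index x zs) -(@nth_take i.+1) //; apply: mem_nth.
  by rewrite size_takel.
have NyB z : z \in s -> (z == y) || e y z -> z \in b :: drop j p.
  have dE : b :: drop j p = drop j s by rewrite (drop_nth x js).
  move=> zs; rewrite dE => /orP[/eqP->|eyz].
    have <- : last b (drop j p) = y := last_drop_nth js.
    by rewrite -dE; exact: mem_last.
  have zi : j <= index z s by apply: jmin; rewrite index_mem zs nth_index.
  rewrite -(nth_index x zs) -(subnKC zi) -nth_drop mem_nth // size_drop.
  by rewrite ltn_sub2r // index_mem.
have xs : x \in s by apply: mem_head.
have ys : y \in s by apply: mem_last.
set NX := [set z in s | e x z]; set NY := [set z in s | e y z].
have cover : (x |: NX) :|: (y |: NY) \subset [set z in c].
  apply/subsetP => z; rewrite !inE.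
  case/orP=> [/orP[/eqP zx|/andP[zs xz]]|/orP[/eqP zy|/andP[zs yz]]].
  - by rewrite zx; apply: Ac; [apply: NxA|]; rewrite ?eqxx.
  - by apply: Ac; [apply: NxA|]; rewrite ?xz ?orbT.
  - by rewrite zy; apply: Bc; [apply: NyB|]; rewrite ?eqxx.
  - by apply: Bc; [apply: NyB|]; rewrite ?yz ?orbT.
have meet : (x |: NX) :&: (y |: NY) \subset [set b].
  apply/subsetP => z; rewrite !inE => /andP[zX zY].
  have zA : z \in A.
    by case/orP: zX => [/eqP->|/andP[zs xz]]; apply: NxA; rewrite ?eqxx ?xz ?orbT.
  have : z \in b :: drop j p.
    by case/orP: zY => [/eqP->|/andP[zs yz]]; apply: NyB; rewrite ?eqxx ?yz ?orbT.
  by rewrite inE => /orP[//|zT]; have := dAT z zA; rewrite inE zT.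
have szc : #|[set z in c]| = size c by rewrite cardsE (card_uniqP uc).
have := subset_leq_card cover; have := subset_leq_card meet.
rewrite szc cards1 cardsU !cardsU1 !inE irr irr !andbF /=.
have := nc c cc uc.
by move: (size c) #|NX| #|NY| #|_ :&: _|; clear; lia.
Qed.

End Linkage.

(** * Edge-maximal graphs without long cycles *)

Definition ndeg (V : finType) (e : rel V) (x : V) (S : {set V}) : nat :=
  \sum_(y in S) e x y.

(** Ordered pairs of adjacent vertices in [S], that is twice the number of edges
    inside [S]. *)
Definition arcs (V : finType) (e : rel V) (S : {set V}) : nat :=
  \sum_(x in S) ndeg e x S.

(** The consequence of edge-maximality used below: adding an edge between
    non-adjacent [x] and [y] would close a cycle of length at least [k]. *)
Definition saturated (V : finType) (k : nat) (e : rel V) : Prop :=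
  forall x y, x != y -> ~~ e x y ->
    exists p, [/\ path e x p, uniq (x :: p), last x p = y & k <= size (x :: p)].

Section Saturation.
Variables (V : finType) (k : nat).
Hypothesis k3 : 2 < k.

Lemma two_connected_sub (e e' : rel V) :
  subrel e e' -> two_connected e -> two_connected e'.
Proof.
move=> ee' te z x y xz yz; apply: connect_sub (te z x y xz yz) => a b.
by case/and3P=> /ee' eab az bz; apply: connect1; rewrite eab az.
Qed.

(** A long cycle that appears when the edge between [x] and [y] is added passes
    through this edge, only once; the rest of the cycle is the path. *)
Lemma cycle_through_new_edge (e e' : rel V) x y (c : seq V) :
  symmetric e -> no_cycle_ge k e ->
  (forall a b, e' a b -> e a b || ([set a; b] == [set x; y])) ->
  cycle e' c -> uniq c -> k <= size c ->
  exists p, [/\ path e x p, uniq (x :: p), last x p = y & k <= size (x :: p)].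
Proof.
move=> sym_e nc new cc uc kc.
have [z zc nz] : exists2 z, z \in c & ~~ e z (next c z).
  apply/exists_inP; apply: contraT => /exists_inPn H.
  have /nc : cycle e c.
    by apply: cycle_from_next => // z zc; have := H z zc; rewrite negbK.
  by move/(_ uc); lia.
have [i q rE] := rot_to zc.
have szq : size (z :: q) = size c by rewrite -rE size_rot.
case: q rE szq => [|b q] rE szq; first by rewrite /= in szq; lia.
have bE : next c z = b by rewrite -(next_rot i uc) rE /= eqxx.
move: uc cc; rewrite -(rot_uniq i) -(rot_cycle i) rE => uc /= /andP[ezb ebq].
rewrite bE in nz.
(* The step from z to b on the cycle is the new edge. *)
have zbE : [set z; b] = [set x; y].
  by have := new _ _ ezb; rewrite (negPf nz) => /eqP.
have eq : path e b (rcons q z).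
  move: uc => /= /and3P[]; rewrite inE negb_or => /andP[zb zq] bq _.
  move: ebq; rewrite !rcons_path => /andP[ebq elz]; apply/andP; split.
    apply: (@sub_in_path _ (predC1 z) e' e) ebq.
      move=> u v uz vz /new /orP[//|]; rewrite -zbE => /eqP E.
      have : z \in [set u; v] by rewrite E set21.
      by rewrite !inE ![z == _]eq_sym (negPf uz) (negPf vz).
    apply/allP => u; rewrite inE => /orP[/eqP->|uq] /=; first by rewrite eq_sym.
    by apply: contraNneq zq => <-.
  have /new /orP[//|/eqP E] := elz.
  have lb : last b q != b.
    case: (q) bq szq => [|d q'] /=; first by lia.
    move=> bq _; apply: contraNneq bq => <-; exact: mem_last.
  have : b \in [set last b q; z] by rewrite E -zbE set22.
  by rewrite !inE ![b == _]eq_sym (negPf lb) (negPf zb).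
have up : uniq (b :: rcons q z).
  by move: uc; rewrite -rcons_cons rcons_uniq /= inE.
have szp : k <= size (b :: rcons q z) by rewrite /= size_rcons; rewrite /= in szq; lia.
have lp : last b (rcons q z) = z by rewrite last_rcons.
have [bx|bx] := eqVneq b x.
  exists (rcons q z); rewrite -bx; split=> //; rewrite lp.
  have : y \in [set z; b] by rewrite zbE set22.
  rewrite !inE => /orP[/eqP //|/eqP yb].
  have : z \in [set x; y] by rewrite -zbE set21.
  by rewrite yb -bx !inE orbb => /eqP.
have zx : z = x.
  have : x \in [set z; b] by rewrite zbE set21.
  by rewrite !inE [x == b]eq_sym (negPf bx) orbF => /eqP.
have yb : b = y.
  have : b \in [set x; y] by rewrite -zbE set22.
  by rewrite !inE (negPf bx) => /eqP.
have [p [h1 h2 h3 h4]] := rev_path_ends sym_e eq up.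
rewrite lp zx yb in h1 h2 h3 h4; rewrite zx yb in up szp.
by exists p; split=> //; move: szp; rewrite -(perm_size (uniq_perm h3 up h4)).
Qed.

(** An edge-maximal extension without long cycles. *)
Lemma saturation (e : rel V) : symmetric e -> irreflexive e -> no_cycle_ge k e ->
  exists e' : rel V, [/\ subrel e e', symmetric e', irreflexive e',
    no_cycle_ge k e' & saturated k e'].
Proof.
move=> se ie nce.
pose R (E : {set V * V}) : rel V := fun x y => (x, y) \in E.
pose P (E : {set V * V}) := `[< [/\ symmetric (R E), irreflexive (R E) & no_cycle_ge k (R E)] >].
pose E0 : {set V * V} := [set u | e u.1 u.2].
have RE0 : R E0 =2 e by move=> a b; rewrite /R inE.
have P0 : P E0.
  apply/asboolP; split.
  - by move=> a b; rewrite !RE0.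
  - by move=> a; rewrite RE0.
  - by move=> c; rewrite (eq_cycle RE0); apply: nce.
have [E mE sE] := maxset_exists P0.
have [/asboolP[sR iR nR] maxE] := maxsetP mE.
exists (R E); split=> //; first by move=> a b eab; apply: (subsetP sE); rewrite inE.
move=> x y xy nxy.
pose E' := (x, y) |: ((y, x) |: E).
have new a b : R E' a b -> R E a b || ([set a; b] == [set x; y]).
  rewrite /R !inE !xpair_eqE => /or3P[/andP[/eqP-> /eqP->]|/andP[/eqP-> /eqP->]|->] //.
    by rewrite eqxx orbT.
  by rewrite setUC eqxx orbT.
have nP : ~ P E'.
  move=> PE'; have : E' = E by apply: maxE => //; rewrite /E' setUA subsetUr.
  by move/setP/(_ (x, y)); rewrite /E' !inE eqxx /= => E1; rewrite /R -E1 in nxy.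
have [c [cc uc kc]] : exists c, [/\ cycle (R E') c, uniq c & k <= size c].
  apply: contra_notP nP => nc; apply/asboolP; split.
  - move=> a b; have := sR a b; rewrite /R !inE => ->.
    rewrite !xpair_eqE [(b == x) && _]andbC [(b == y) && _]andbC.
    by case: (_ && _) => //; rewrite orbT.
  - move=> a; have := iR a; rewrite /R !inE => ->; rewrite !xpair_eqE orbF.
    by apply: contraNF xy; case/orP=> /andP[/eqP<- /eqP<-].
  - move=> c cc uc; rewrite ltnNge; apply/negP => kc; apply: nc.
    by exists c.
exact: (cycle_through_new_edge sR nR new cc uc kc).
Qed.
End Saturation.

(** * Counting edges and disintegration *)

Section Counting.
Variables (V : finType).
Implicit Types (e : rel V) (S T C : {set V}).

Lemma ndeg_card e x S : ndeg e x S = #|[set y in S | e x y]|.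
Proof.
rewrite /ndeg -big_mkcondr sum1dep_card; apply: eq_card => y.
by rewrite !inE.
Qed.

Lemma ndeg_subset e x S T : S \subset T -> ndeg e x S <= ndeg e x T.
Proof.
move=> ST; rewrite !ndeg_card; apply/subset_leq_card/subsetP => y.
by rewrite !inE => /andP[/(subsetP ST)-> ->].
Qed.

Lemma ndeg_subrel e e' x S : subrel e e' -> ndeg e x S <= ndeg e' x S.
Proof.
by move=> ee'; apply: leq_sum => y _; case: (boolP (e x y)) => // /ee' ->.
Qed.

Lemma arcs_setD1 e x S : symmetric e -> irreflexive e -> x \in S ->
  arcs e S = arcs e (S :\ x) + (ndeg e x S).*2.
Proof.
move=> se ie xS; rewrite /arcs (big_setD1 x) //=.
have -> : \sum_(y in S :\ x) ndeg e y S =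
          \sum_(y in S :\ x) (e x y + ndeg e y (S :\ x)).
  by apply: eq_bigr => y _; rewrite {1}/ndeg (big_setD1 x) //= se.
have dE : ndeg e x S = \sum_(y in S :\ x) e x y.
  by rewrite /ndeg (big_setD1 x) //= ie.
by rewrite big_split /= -dE addnA addnn addnC.
Qed.

Lemma arcs_le e S : irreflexive e -> arcs e S <= #|S| * #|S|.-1.
Proof.
move=> ie; rewrite -sum_nat_const; apply: leq_sum => x xS.
rewrite ndeg_card (cardsD1 x S) xS /=; apply/subset_leq_card/subsetP => y.
by rewrite !inE => /andP[-> exy]; rewrite andbT; apply: contraTneq exy => ->; rewrite ie.
Qed.

(** Vertices outside [C] can be deleted one after another, each of degree at
    most [a] when its turn comes. *)
Lemma arcs_peel e a C T : symmetric e -> irreflexive e ->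
  (forall S, C \proper S -> exists2 x, x \in S :\: C & ndeg e x S <= a) ->
  C \subset T -> arcs e T <= arcs e C + (a * (#|T| - #|C|)).*2.
Proof.
move=> se ie H; elim: {T}_.+1 {-2}T (ltnSn #|T|) => // n IH T Tn CT.
have [->|CTn] := eqVneq C T; first by rewrite leq_addr.
have CpT : C \proper T by rewrite properEneq CTn.
have [x /setDP[xT xC] dx] := H T CpT.
have cT := cardsD1 x T; rewrite xT in cT.
have CT' : C \subset T :\ x by rewrite subsetD1 CT.
have sz : #|T :\ x| < n by move: Tn; rewrite cT.
have := IH (T :\ x) sz CT'; rewrite (arcs_setD1 se ie xT) cT add1n.
by rewrite subSn ?subset_leq_card // mulnS doubleD; move: dx; clear; lia.
Qed.

(** The deletion stops at [s] vertices rather than at the empty set: the last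
    vertices span fewer edges than degeneracy alone predicts, and counting these
    separately gives the sharp constant. *)
Lemma arcs_degenerate e a s T : symmetric e -> irreflexive e ->
  (forall S, S != set0 -> exists2 x, x \in S & ndeg e x S <= a) ->
  s <= #|T| -> exists2 U : {set V}, #|U| = s &
    arcs e T <= arcs e U + (a * (#|T| - s)).*2.
Proof.
move=> se ie H; elim: {T}_.+1 {-2}T (ltnSn #|T|) => // n IH T Tn sT.
have [<-|sTn] := eqVneq #|T| s.
  by exists T => //; rewrite leq_addr.
have [|x xT dx] := H T; first by rewrite -card_gt0; lia.
have cT := cardsD1 x T; rewrite xT in cT.
have [||U Us hU] := IH (T :\ x); [lia|lia|].
exists U => //; rewrite (arcs_setD1 se ie xT).
have -> : #|T| - s = (#|T :\ x| - s).+1 by lia.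
by rewrite mulnS doubleD; lia.
Qed.

(** What remains after deleting vertices of degree at most [a] as long as
    possible; as the union of all sets of minimum degree above [a] it does not
    depend on the order of deletion. *)
Definition core e a : {set V} :=
  \bigcup_(S : {set V} | [forall x in S, a < ndeg e x S]) S.

Lemma core_max e a S : (forall x, x \in S -> a < ndeg e x S) -> S \subset core e a.
Proof. by move=> H; apply: (bigcup_sup S) => //; apply/forall_inP. Qed.

Lemma core_deg e a x : x \in core e a -> a < ndeg e x (core e a).
Proof.
case/bigcupP => S HS xS; have /forall_inP H := HS.
apply: leq_trans (H x xS) _; apply: ndeg_subset; exact: (bigcup_sup S).
Qed.

Lemma core_proper e a S : core e a \proper S ->
  exists2 x, x \in S :\: core e a & ndeg e x S <= a.
Proof.
move=> CS; apply/exists_inP; apply: contraT => /exists_inPn H.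
suff : S \subset core e a by rewrite (negPf (proper_subn CS)).
apply: core_max => x xS; have [xC|xC] := boolP (x \in core e a).
  by apply: leq_trans (core_deg xC) _; apply: ndeg_subset; apply: proper_sub.
by rewrite ltnNge; apply: H; rewrite inE xC.
Qed.
End Counting.

(** * Two-connected graphs *)

Section Block.
Variables (V : finType) (k : nat).
Hypothesis k3 : 2 < k.

(** For a non-adjacent pair take a long path between the two sets.  A neighbour
    of one end off the path, inside that end's set, would close a long cycle or
    prolong the path to one between another non-adjacent pair.  So a path that
    cannot be prolonged carries all these neighbours, at least [d1 + d2], against
    [path_degree_sum]. *)
Lemma saturated_join (e : rel V) (C1 C2 : {set V}) d1 d2 :
  symmetric e -> irreflexive e -> two_connected e -> no_cycle_ge k e -> saturated k e ->
  (forall x, x \in C1 -> d1 <= ndeg e x C1) ->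
  (forall y, y \in C2 -> d2 <= ndeg e y C2) -> k <= d1 + d2 ->
  forall x y, x \in C1 -> y \in C2 -> x != y -> e x y.
Proof.
move=> se ie te nc sat D1 D2 kd.
suff main n : forall x y p, #|V| - size p < n -> x \in C1 -> y \in C2 ->
    path e x p -> uniq (x :: p) -> last x p = y -> ~~ e x y -> x != y ->
    k <= size (x :: p) -> False.
  move=> x y xC yC xy; apply: contraT => nxy.
  have [p [ep up lp kp]] := sat x y xy nxy.
  by case: (main _ x y p (ltnSn _) xC yC ep up lp nxy xy kp).
elim: n => // n IH x y p pn xC yC ep up lp nxy xy kp.
have pV : size p < #|V|.
  by have := max_card (mem (x :: p)); rewrite (card_uniqP up).
have measure (q : seq V) : size q = (size p).+1 -> #|V| - size q < n.
  by move=> ->; move: pn pV; clear; lia.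
have [[x' [x'C xx' x'p]]|nX] :=
    pselect (exists x', [/\ x' \in C1, e x x' & x' \notin x :: p]).
  have [x'y|nx'y] := boolP (e x' y).
    have cc : cycle e (x' :: x :: p) by rewrite /= se xx' rcons_path ep lp se.
    have uc : uniq (x' :: x :: p) by rewrite cons_uniq x'p.
    by move: (nc _ cc uc) kp => /=; clear; lia.
  apply: (IH x' y (x :: p)) => //=.
  - exact: (measure (x :: p) erefl).
  - by rewrite se xx'.
  - by rewrite -cons_uniq cons_uniq x'p.
  - by apply: contraNneq x'p => ->; rewrite -lp mem_last.
  - exact: leqW.
have [[y' [y'C yy' y'p]]|nY] :=
    pselect (exists y', [/\ y' \in C2, e y y' & y' \notin x :: p]).
  have [xy'|nxy'] := boolP (e x y').
    have cc : cycle e (x :: rcons p y').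
      by rewrite /= !rcons_path ep lp yy' last_rcons se.
    have uc : uniq (x :: rcons p y') by rewrite -rcons_cons rcons_uniq y'p.
    by move: (nc _ cc uc) kp; rewrite /= size_rcons; clear; lia.
  apply: (IH x y' (rcons p y')) => //.
  - by apply: measure; rewrite size_rcons.
  - by rewrite rcons_path ep lp.
  - by rewrite -rcons_cons rcons_uniq y'p.
  - by rewrite last_rcons.
  - by apply: contraNneq y'p => <-; rewrite mem_head.
  - by rewrite /= size_rcons; exact: leqW.
have p0 : 0 < size p by case: (p) lp xy => //= ->; rewrite eqxx.
have := path_degree_sum se te ie nc ep up kp p0; rewrite lp ltnNge => /negP; apply.
apply: leq_trans kd _; apply: leq_add.
  apply: leq_trans (D1 x xC) _; rewrite ndeg_card; apply/subset_leq_card/subsetP => z.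
  rewrite !inE => /andP[zC xz]; rewrite xz andbT -in_cons.
  by apply: contra_notT nX => zp; exists z.
apply: leq_trans (D2 y yC) _; rewrite ndeg_card; apply/subset_leq_card/subsetP => z.
rewrite !inE => /andP[zC yz]; rewrite yz andbT -in_cons.
by apply: contra_notT nY => zp; exists z.
Qed.

Lemma clique_cycle (e : rel V) (C : {set V}) :
  (forall x y, x \in C -> y \in C -> x != y -> e x y) -> 2 < #|C| -> cycle e (enum C).
Proof.
move=> H C2; apply: cycle_from_next; first exact: enum_uniq.
move=> x xC; have nC : next (enum C) x \in C by rewrite -mem_enum mem_next.
rewrite mem_enum in xC; apply: H => //.
have [i q rE] := rot_to (etrans (mem_enum C x) xC).
rewrite -(next_rot i (enum_uniq C)) rE /=.
have := enum_uniq C; rewrite -(rot_uniq i) rE.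
have : size (rot i (enum C)) = #|C| by rewrite size_rot cardE.
rewrite rE; case: q {rE} => [|b q] /=; first by lia.
by rewrite eqxx inE negb_or => _ /andP[/andP[]].
Qed.

(** The disintegration of an edge-maximal extension [e'] of [e].  Its [h]-core
    [C] is empty, which bounds the edges by degeneracy, or it is joined to
    itself by [saturated_join] and so is a clique with [h.+2] vertices or more.
    In that case [saturated_join], applied to [C] and to the core for
    [k - #|C|], shows that this larger core is also [C]: a vertex outside [C]
    would be adjacent to all of [C] and have survived the first disintegration.
    The edges inside [C] are left as a count in [e], since only [e] and not [e']
    is known to be free of large cliques. *)
Lemma block_bound (e : rel V) h :
  symmetric e -> irreflexive e -> two_connected e -> no_cycle_ge k e ->
  0 < h -> k <= h.*2.+2 -> h < #|V| ->
  arcs e setT + h * h.-1 <= (h * #|V|.-1).*2 \/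
  exists C : {set V}, [/\ h.+1 < #|C|, #|C| < k &
    arcs e setT <= arcs e C + ((k - #|C|) * (#|V| - #|C|)).*2].
Proof.
move=> se ie te nc h0 kh hV.
have [e' [ee' se' ie' nc' sat']] := saturation k3 se ie nc.
have te' := two_connected_sub ee' te.
have [C0|C0] := eqVneq (core e' h) set0.
  left.
  have [||U Us hU] := @arcs_degenerate V e h h.+1 setT se ie.
  - move=> S S0; have [|x] := @core_proper V e' h S; first by rewrite C0 proper0.
    rewrite C0 setD0 => xS dx; exists x => //.
    by apply: leq_trans dx; apply: ndeg_subrel.
  - by rewrite cardsT.
  have := arcs_le U ie; rewrite Us /= => hU'.
  rewrite cardsT in hU; apply: leq_trans (leq_add hU (leqnn _)) _.
  apply: leq_trans (leq_add (leq_add hU' (leqnn _)) (leqnn _)) _.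
  have [n' ->] : exists n', #|V| = h.+1 + n' by exists (#|V| - h.+1); lia.
  by case: h h0 {kh hV hU hU' C0 Us} => // h _; rewrite addKn /=; nia.
right; set C := core e' h in C0 *.
have degC x : x \in C -> h.+1 <= ndeg e' x C by apply: core_deg.
have clC : forall x y, x \in C -> y \in C -> x != y -> e' x y.
  by apply: (saturated_join se' ie' te' nc' sat' degC degC); lia.
have ndC x : x \in C -> ndeg e' x C = #|C|.-1.
  move=> xC; rewrite ndeg_card (cardsD1 x C) xC /=; apply: eq_card => y.
  rewrite !inE andbC; have [yC|] := boolP (y \in C); last by rewrite !andbF.
  rewrite !andbT; have [->|yx] := eqVneq y x; first by rewrite ie'.
  by apply: clC; rewrite // eq_sym.
have hC : h.+1 < #|C|.
  case/set0Pn: C0 => x xC; have := degC x xC; rewrite ndC //; lia.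
have Ck : #|C| < k.
  have /nc' : cycle e' (enum C) by apply: clique_cycle => //; lia.
  by rewrite -cardE; apply; exact: enum_uniq.
exists C; split=> //; rewrite -cardsT.
apply: arcs_peel => //.
(* As k - s <= h for s = #|C|, less is deleted and this core can only be larger. *)
have CD : C = core e' (k - #|C|).
  have CsD : C \subset core e' (k - #|C|).
    by apply: core_max => x /degC; apply: leq_trans; lia.
  apply/eqP; rewrite eqEsubset CsD /=; apply/subsetP => x xD.
  apply: contraT => xC; have xC' := xC.
  have adj y : y \in C -> e' x y.
    move=> yC; apply: (@saturated_join e' (core e' (k - #|C|)) C (k - #|C|).+1 #|C|.-1) => //.
    - by move=> z /core_deg.
    - by move=> z zC; rewrite ndC.
    - lia.
    - by apply: contraNneq xC => ->.
  case/negP: xC; rewrite -sub1set; apply: subset_trans (subsetUl [set x] C) _.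
  apply: core_max => z; rewrite !inE => /orP[/eqP->|zC].
    apply: leq_trans (_ : ndeg e' x C <= _); last by apply: ndeg_subset; apply: subsetUr.
    rewrite ndeg_card; apply: leq_trans (ltnW hC) _; apply: subset_leq_card.
    by apply/subsetP => y yC; rewrite inE yC adj.
  apply: leq_trans (degC z zC) _; apply: ndeg_subset; apply: subsetUr.
move=> S; rewrite {1}CD => /core_proper[x xS dx]; exists x; first by rewrite CD.
by apply: leq_trans dx; apply: ndeg_subrel.
Qed.
End Block.

(** * Arithmetic of the windmill bound *)

(** Twice ex([q.+1], K_r), as long as there are at most twice
    as many vertices as classes, [r - 1] of them: the complement is then a matching with
    [q.+2 - r] edges.  The shift by one makes the windmill bound additive. *)
Definition turan2 r q := q * q.+1 - (q.+2 - r).*2.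

Lemma turan2E r q : 1 < r -> turan2 r q + (q.+2 - r).*2 = q * q.+1.
Proof. move=> r1; rewrite /turan2 subnK //. case: q => [|[|q]]; nia. Qed.

(** The increments of [turan2 r] do not decrease. *)
Lemma turan2_convex r d a b : 1 < r ->
  turan2 r (d + a) + turan2 r (d + b) <= turan2 r (d + a + b) + turan2 r d.
Proof.
move=> r1.
have := turan2E (d + a) r1; have := turan2E (d + b) r1.
have := turan2E (d + a + b) r1; have := turan2E d r1.
have ab : minn a b <= a * b by case: a b => [|a] [|b]; nia.
nia.
Qed.

(** Twice f(x+1,k,r), with [turan2] in the place of the Turan numbers. *)
Definition windmill2 k r x :=
  x %/ (k - 2) * turan2 r (k - 2) + turan2 r (x %% (k - 2)).

Section Numerics.
Variables (k r : nat).
Hypotheses (k3 : 2 < k) (r1 : 1 < r).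

Lemma windmill2E p q : q <= k - 2 ->
  windmill2 k r (p * (k - 2) + q) = p * turan2 r (k - 2) + turan2 r q.
Proof.
have k0 : 0 < k - 2 by lia.
rewrite leq_eqVlt => /orP[/eqP->|qk].
  have -> : p * (k - 2) + (k - 2) = p.+1 * (k - 2) by rewrite mulSn addnC.
  rewrite /windmill2 mulnK // modnMl mulSn addnAC addnC; congr (_ + _).
  by rewrite /turan2; lia.
by rewrite /windmill2 divnMDl // divn_small // addn0 modnMDl modn_small.
Qed.

Lemma windmill2_decomp x : exists p q, x = p * (k - 2) + q /\ q < k - 2.
Proof.
exists (x %/ (k - 2)), (x %% (k - 2)); rewrite -divn_eq ltn_mod; split=> //; lia.
Qed.

(** Convexity allows to shift vertices from one incomplete blade to the other
    until it is empty or the other one is complete. *)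
Lemma windmill2_superadd a b :
  windmill2 k r a + windmill2 k r b <= windmill2 k r (a + b).
Proof.
have [p1 [q1 [-> h1]]] := windmill2_decomp a.
have [p2 [q2 [-> h2]]] := windmill2_decomp b.
rewrite !windmill2E; try lia.
have [h|h] := leqP (q1 + q2) (k - 2).
  rewrite [_ + _ + (_ + q2)]addnACA -mulnDl windmill2E // addnACA -mulnDl leq_add2l.
  have := turan2_convex 0 q1 q2 r1; rewrite !add0n.
  have -> : turan2 r 0 = 0 by rewrite /turan2; lia.
  by rewrite addn0.
have [d dE] : exists d, q1 + q2 = k - 2 + d by exists (q1 + q2 - (k - 2)); lia.
have -> : p1 * (k - 2) + q1 + (p2 * (k - 2) + q2) = (p1 + p2).+1 * (k - 2) + d.
  by rewrite mulSn mulnDl; lia.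
rewrite windmill2E; last by lia.
have := turan2_convex d (q1 - d) (q2 - d) r1.
have -> : d + (q1 - d) = q1 by lia.
have -> : d + (q2 - d) = q2 by lia.
have -> : q1 + (q2 - d) = k - 2 by lia.
by rewrite mulSn mulnDl; lia.
Qed.

(** A blade with [q] vertices besides the centre has at most q(q+1)/2 edges, and
    (q+1)/2 <= h since [q < k - 1]. *)
Lemma windmill2_le_slope h x : k - 1 <= h.*2 -> windmill2 k r x <= (h * x).*2.
Proof.
move=> kh; have [p [q [-> hq]]] := windmill2_decomp x.
rewrite windmill2E; last by lia.
have H q' : q' <= k - 2 -> turan2 r q' <= (h * q').*2 by move=> h'; rewrite /turan2; nia.
have := H q; have := H (k - 2); nia.
Qed.

(** Inside an incomplete blade the bound falls behind the line of slope [a] while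
    its increments are below [a]; the total loss is at most 1 + ... + (a-1). *)
Lemma windmill2_ge_slope a x : a.+2 <= r -> (a * (k - 2)).*2 <= turan2 r (k - 2) ->
  (a * x).*2 <= windmill2 k r x + a * a.-1.
Proof.
move=> ar aT; have [p [q [-> hq]]] := windmill2_decomp x.
rewrite windmill2E; last by lia.
have H : (a * q).*2 <= turan2 r q + a * a.-1.
  have := turan2E q r1; case: (leqP a q) => aq.
    have [z ->] : exists z, q = a + z by exists (q - a); lia.
    have : ((a + z).+2 - r).*2 <= z.*2 by lia.
    case: (a) => [|a']; case: z => [|z]; nia.
  have -> : q.+2 - r = 0 by lia.
  have [z ->] : exists z, a = q.+1 + z by exists (a - q.+1); lia.
  rewrite /=; nia.
nia.
Qed.

(** The bound for a clique of [k - a] vertices followed by vertices of degree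
    [a].  Writing [x = k - 2 + y] splits off one complete blade.  Its surplus
    over the clique consists of the last [a - 1] increments of [turan2 r]; these
    make up both for the [a - 1] further vertices of degree [a] and for the loss
    in [windmill2_ge_slope]. *)
Lemma block_numeric a x :
  0 < a -> a.*2 <= k - 2 -> a.+2 <= r -> (a * (k - 2)).*2 <= turan2 r (k - 2) ->
  k - 2 < x ->
  turan2 r (k - a).-1 + (a * (x.+1 - (k - a))).*2 <= windmill2 k r x.
Proof.
move=> a0 ak ar aT kx.
have [y ->] : exists y, x = k - 2 + y by exists (x - (k - 2)); lia.
have := windmill2_ge_slope y ar aT.
have -> : windmill2 k r (k - 2 + y) = turan2 r (k - 2) + windmill2 k r y.
  have [p [q [-> hq]]] := windmill2_decomp y.
  have -> : k - 2 + (p * (k - 2) + q) = p.+1 * (k - 2) + q by rewrite mulSn addnA.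
  by rewrite !windmill2E; try lia; rewrite mulSn addnA.
have := turan2E (k - a).-1 r1; have := turan2E (k - 2) r1.
have [c kE] : exists c, k = a.*2 + 2 + c by exists (k - (a.*2 + 2)); lia.
have [b aE] : exists b, a = b.+1 by exists a.-1; lia.
have -> : (k - 2 + y).+1 - (k - a) = y + b by lia.
have -> : (k - a).-1 = b.*2 + 2 + c - b by lia.
have -> : k - 2 = b.*2 + 2 + c by lia.
rewrite aE /=.
have : ((b.*2 + 2 + c).+2 - r).*2 <= (((b.*2 + 2 + c - b).+2 - r).*2) + b.*2 by lia.
have -> : b.*2 + 2 + c - b = b + 2 + c by lia.
have key : (b + 2 + c) * (b + 2 + c).+1 + (b * b + b).*2 + (b * b + b) + b.*2 + (b * c).*2
  = (b.*2 + 2 + c) * (b.*2 + 2 + c).+1 by clear; nia.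
rewrite mulnDr.
have -> : b.+1 * b = b * b + b by rewrite mulSn addnC.
move: key; clear.
move: ((b + 2 + c) * _) ((b.*2 + 2 + c) * _) (b * b) (b * c) (b.+1 * y) => m1 m2 m3 m4 m5.
move: (windmill2 k r y) (turan2 r _) (turan2 r _) => P T1 T2; lia.
Qed.
End Numerics.

(** * Induction over cut vertices *)

Definition cliquefree (V : finType) (r : nat) (e : rel V) : Prop :=
  forall S : {set V},
    (forall x y, x \in S -> y \in S -> x != y -> e x y) -> #|S| < r.

Section Pullback.
Variables (V W : finType) (f : W -> V) (e : rel V).
Hypothesis inj_f : injective f.

Lemma no_cycle_ge_pullback k : no_cycle_ge k e -> no_cycle_ge k (relpre f e).
Proof.
move=> nc c; rewrite -cycle_map -(map_inj_uniq inj_f) -(size_map f).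
exact: nc.
Qed.

Lemma cliquefree_pullback r : cliquefree r e -> cliquefree r (relpre f e).
Proof.
move=> cf S clS; rewrite -(card_imset _ inj_f).
apply: cf => _ _ /imsetP[x xS ->] /imsetP[y yS ->] xy.
by apply: clS => //; apply: contraNneq xy => ->.
Qed.
End Pullback.

(** While there are at least [r] vertices, some pair is not adjacent, and
    deleting one vertex of the pair loses at least one missing edge. *)
Lemma arcs_turan (V : finType) (e : rel V) r (S : {set V}) :
  symmetric e -> irreflexive e -> cliquefree r e ->
  arcs e S + (#|S|.+1 - r).*2 <= #|S| * #|S|.-1.
Proof.
move=> se ie cf; elim: {S}_.+1 {-2}S (ltnSn #|S|) => // n IH S Sn.
have [Sr|rS] := ltnP #|S| r.
  by have := arcs_le S ie; rewrite (eqP (_ : #|S|.+1 - r == 0)) ?addn0 // subn_eq0.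
have [[x [y [xS yS xy nxy]]]|H] :=
    pselect (exists x y, [/\ x \in S, y \in S, x != y & ~~ e x y]); last first.
  have : #|S| < r.
    by apply: cf => x y xS yS xy; apply: contra_notT H => nxy; exists x, y.
  by rewrite ltnNge rS.
have cS := cardsD1 x S; rewrite xS in cS.
have cS' := cardsD1 y (S :\ x); rewrite !inE eq_sym xy yS /= in cS'.
have dx : ndeg e x S <= #|S :\ x :\ y|.
  rewrite ndeg_card; apply/subset_leq_card/subsetP => z; rewrite !inE.
  case/andP=> -> exz; rewrite andbT; apply/andP; split.
    by apply: contraNneq nxy => <-.
  by apply: contraTneq exz => ->; rewrite ie.
have sz : #|S :\ x| < n by lia.
have := IH _ sz; rewrite (arcs_setD1 se ie xS).
move: cS cS' dx rS; rewrite !add1n.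
move: #|S :\ x :\ y| => u -> -> dx rS.
move: (arcs _ _) (ndeg _ _ _) dx => A d dx; rewrite /=.
have -> : u.+3 - r = (u.+2 - r).+1 by lia.
nia.
Qed.

Section Upper.
Variables (k r h : nat).
Hypotheses (hE : h = k.-1./2) (h2 : 1 < h) (hr : h.+2 <= r) (rk : r < k).

Let k3 : 2 < k. Proof. lia. Qed.
Let r1 : 1 < r. Proof. lia. Qed.

(** The two extremal configurations for [n.+1] vertices, with doubled counts; the
    second one says that there are at most h(h-1)/2 + h(n+1-h) edges. *)
Definition edge_bound n a := a <= windmill2 k r n \/ a + h * h.-1 <= (h * n).*2.

(** The condition on [a] means [a <= h] for even [k], [a < h] for odd [k].  For
    even [k] and [r = h + 2] there is equality at [a = h]. *)
Lemma turan2_slope a : a <= k - h.+2 -> (a * (k - 2)).*2 <= turan2 r (k - 2).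
Proof.
move=> ak; have := turan2E (k - 2) r1.
have [b bE] : exists b, a + b = k - h.+2 by exists (k - h.+2 - a); lia.
have [m [mE hm]] : exists m, k - 2 = m /\ h.*2 <= m.+1 /\ m <= h.*2 by exists (k - 2); lia.
rewrite mE.
have : ((m.+2 - r).*2 <= (m - h).*2) by lia.
have ahm : a <= m - h by lia.
move: (turan2 r m) (_ - r) => T u.
have [c cE] : exists c, h = c.+1 by exists h.-1; lia.
have am : (a * m).*2 <= ((m - h) * m).*2 by rewrite leq_double leq_mul2r ahm orbT.
move=> uT TE; apply: leq_trans am _.
have [mE2|mE2] : m = c.*2.+1 \/ m = c.*2.+2 by lia.
  have mh : m - h = c by lia.
  by move: uT TE; rewrite mh mE2; clear; nia.
have mh : m - h = c.+1 by lia.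
by move: uT TE; rewrite mh mE2; clear; nia.
Qed.

(** For even [k] complete blades gain at least [h] edges per vertex, so the second
    alternative is subsumed by the first. *)
Lemma even_bound n a : ~~ odd k -> edge_bound n a -> a <= windmill2 k r n.
Proof.
move=> ek [//|H].
have := @windmill2_ge_slope k r k3 r1 h n hr; rewrite turan2_slope; last by lia.
by move=> /(_ isT); lia.
Qed.

(** For even [k] only windmill bounds are added, which is superadditivity.  For
    odd [k] both alternatives lie below the line of slope [h] through 0, so any
    summand can be attached to a graph of the second kind. *)
Lemma edge_bound_add n1 n2 a1 a2 :
  edge_bound n1 a1 -> edge_bound n2 a2 -> edge_bound (n1 + n2) (a1 + a2).
Proof.
have S := windmill2_superadd k3 r1 n1 n2.
have [ok|ek] := boolP (odd k); last first.
  by move=> /(even_bound ek) H1 /(even_bound ek) H2; left; lia.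
have k1 : k - 1 <= h.*2 by lia.
have L1 := windmill2_le_slope k3 r1 n1 k1.
have L2 := windmill2_le_slope k3 r1 n2 k1.
rewrite /edge_bound mulnDr; move: S L1 L2.
move: (windmill2 k r (n1 + n2)) (windmill2 k r n1) (windmill2 k r n2).
move: (h * n1) (h * n2) (h * h.-1) => m1 m2 c P P1 P2 S L1 L2.
by move=> [H1|H1] [H2|H2]; [left|right|right|right]; clear -S L1 L2 H1 H2; lia.
Qed.

Lemma arcs_setT_sub (V : finType) (e : rel V) (S : {set V}) :
  arcs (relpre (val : {x | x \in S} -> V) e) setT = arcs e S.
Proof.
rewrite /arcs [RHS]big_sub; apply: eq_big => x; first by rewrite inE.
by move=> _; rewrite /ndeg [RHS]big_sub; apply: eq_big => y; rewrite ?inE.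
Qed.

Lemma arcs_mkcond (V : finType) (e : rel V) (S : {set V}) :
  arcs e S = \sum_x \sum_y [&& x \in S, y \in S & e x y].
Proof.
rewrite /arcs big_mkcond; apply: eq_bigr => x _ /=.
case: (x \in S); last by rewrite /= big1.
by rewrite /ndeg big_mkcond; apply: eq_bigr => y _ /=; case: (y \in S).
Qed.

Lemma arcs_cover (V : finType) (e : rel V) (S T : {set V}) :
  (forall x y, e x y -> (x \in S) && (y \in S) || (x \in T) && (y \in T)) ->
  arcs e setT <= arcs e S + arcs e T.
Proof.
move=> H; rewrite !arcs_mkcond -big_split; apply: leq_sum => x _ /=.
rewrite -big_split; apply: leq_sum => y _ /=; rewrite !inE /=.
case E: (e x y) => //; have := H x y E.
by case: (x \in S); case: (y \in S); case: (x \in T); case: (y \in T).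
Qed.

(** The component of [x] in the graph without [z], and the rest, both with [z]
    added. *)
Lemma cut_cover (V : finType) (e : rel V) : symmetric e -> ~ two_connected e ->
  exists S T : {set V}, [/\ #|S| + #|T| = #|V|.+1, 1 < #|S|, 1 < #|T| &
    forall x y, e x y -> (x \in S) && (y \in S) || (x \in T) && (y \in T)].
Proof.
move=> se nt.
have [z [x [y [xz yz nxy]]]] : exists z x y, [/\ x != z, y != z &
    ~~ connect (fun a b => [&& e a b, a != z & b != z]) x y].
  apply: contra_notP nt => H z x y xz yz; apply: contra_notT H => nxy.
  by exists z, x, y.
set f := (fun a b => _) in nxy.
have sf : symmetric f by move=> a b; rewrite /f se [(b != z) && _]andbC.
have cf : connect_sym f by apply: sym_connect_sym.
pose R := [set a | connect f x a].
have zR : z \notin R.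
  rewrite inE; apply/negP; rewrite cf => /connectP[[|b p] /= H E].
    by rewrite E eqxx in xz.
  by move: H; rewrite {1}/f eqxx !andbF.
exists (z |: R), (~: R); split.
- by rewrite cardsU1 zR add1n addSn cardsC.
- rewrite cardsU1 zR add1n ltnS card_gt0; apply/set0Pn; exists x.
  by rewrite inE connect0.
- apply: leq_trans (_ : #|[set z; y]| <= _); first by rewrite cards2 eq_sym yz.
  by apply/subset_leq_card/subsetP => a; rewrite !inE => /orP[] /eqP -> //; move: zR; rewrite inE.
- move=> a b eab; rewrite !inE.
  have [->|az] := eqVneq a z.
    by move: zR; rewrite inE => -> /=; case: (connect f x b); rewrite ?orbT.
  have [->|bz] := eqVneq b z.
    by move: zR; rewrite inE => -> /=; case: (connect f x a); rewrite ?orbT.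
  have fab : connect f a b by apply: connect1; rewrite /f eab az.
  have -> : connect f x a = connect f x b.
    apply/idP/idP => H; apply: connect_trans H _ => //; by rewrite cf.
  by case: (connect f x b).
Qed.

Theorem upper_bound (V : finType) (e : rel V) :
  symmetric e -> irreflexive e -> no_cycle_ge k e -> cliquefree r e -> 0 < #|V| ->
  edge_bound #|V|.-1 (arcs e setT).
Proof.
have [n] := ubnP #|V|; elim: n V e => // n IH V e Vn se ie nc cf V0.
have bT (S : {set V}) : arcs e S <= turan2 r #|S|.-1.
  have := arcs_turan S se ie cf; rewrite /turan2; case: #|S| => [|s] /=; first by lia.
  by rewrite [s.+1 * s]mulnC; lia.
have [Vk|kV] := ltnP #|V| k.
  left; apply: leq_trans (bT setT) _; rewrite cardsT.
  have -> : windmill2 k r #|V|.-1 = windmill2 k r (0 * (k - 2) + #|V|.-1) by rewrite mul0n.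
  by rewrite windmill2E //; lia.
have [te|nte] := pselect (two_connected e); last first.
  have [S [T [ST S1 T1 cov]]] := cut_cover se nte.
  have sub (A : {set V}) : 1 < #|A| -> #|A| < #|V| -> edge_bound #|A|.-1 (arcs e A).
    move=> A1 AV; rewrite -arcs_setT_sub.
    have cA : #|{: {x | x \in A}}| = #|A|.
      by rewrite card_sig; apply: eq_card => z; rewrite !inE.
    rewrite -cA; apply: IH; rewrite ?cA.
    - lia.
    - by move=> a b; apply: se.
    - by move=> a; apply: ie.
    - exact: (no_cycle_ge_pullback val_inj nc).
    - exact: (cliquefree_pullback val_inj cf).
    - lia.
  have SV : #|S| < #|V| by lia.
  have TV : #|T| < #|V| by lia.
  have cov' := arcs_cover cov.
  have E : #|V|.-1 = #|S|.-1 + #|T|.-1 by lia.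
  have [B|B] := edge_bound_add (sub S S1 SV) (sub T T1 TV).
  - by left; rewrite E; apply: leq_trans B.
  - right; rewrite E; apply: leq_trans B; rewrite leq_add2r //.
have h0 : 0 < h by lia.
have kh : k <= h.*2.+2 by lia.
have hV : h < #|V| by lia.
have [B|[C [hC Ck aC]]] := block_bound k3 se ie te nc h0 kh hV; first by right.
left; apply: leq_trans aC _.
have aE : k - (k - #|C|) = #|C| by lia.
have := @block_numeric k r k3 r1 (k - #|C|) #|V|.-1.
rewrite aE prednK // => num.
apply: leq_trans (leq_add (bT C) (leqnn _)) (num _ _ _ _ _); try lia.
by apply: turan2_slope; lia.
Qed.
End Upper.

(** * Graphs as relations and extremal numbers *)

Section Translation.
Variables (V : finType).
Implicit Types (G : sgraph V).

Lemma adj_sym G : symmetric (adj G).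
Proof. by move=> x y; rewrite /adj setUC. Qed.

Lemma adj_irr G : irreflexive (adj G).
Proof.
move=> x; apply/negP => xE; have /forall_inP/(_ _ xE) := edges_card2 G.
by rewrite setUid cards1.
Qed.

(** Each edge is the image of exactly two ordered pairs. *)
Lemma arcs_num_edges G : arcs (adj G) setT = (num_edges G).*2.
Proof.
have -> : arcs (adj G) setT = \sum_(u : V * V | adj G u.1 u.2) 1.
  rewrite arcs_mkcond pair_big /= big_mkcond [RHS]big_mkcond /=.
  by apply: eq_bigr => u _; rewrite !inE; case: (adj _ _ _).
rewrite (partition_big (fun u => [set u.1; u.2]) (mem (edges G))) //=.
rewrite (eq_bigr (fun _ => 2)) ?sum_nat_const ?muln2 // => E EG.
have /forall_inP/(_ E EG)/cards2P[x [y [xy EE]]] := edges_card2 G.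
rewrite sum1dep_card (_ : [set _ | _] = [set (x, y); (y, x)]).
  by rewrite cards2 xpair_eqE (negPf xy).
apply/setP => -[a b]; rewrite !inE /= !xpair_eqE; apply/andP/orP.
  case=> ab /eqP E2; have /set2P aE : a \in [set x; y] by rewrite -EE -E2 set21.
  have /set2P bE : b \in [set x; y] by rewrite -EE -E2 set22.
  case: aE bE ab => -> [] ->; rewrite ?adj_irr // !eqxx; by [left|right].
have xyG : adj G x y by rewrite /adj -EE.
by case=> /andP[/eqP-> /eqP->]; rewrite ?[adj G y x]adj_sym xyG EE ?eqxx // setUC.
Qed.

Lemma free_complete r G :
  free (fam1 (complete_graph 'I_r)) G <-> cliquefree r (adj G).
Proof.
split=> [fr S clS|cf _ _ [] [f [injf hf]]].
  rewrite ltnNge; apply/negP => rS.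
  apply: (fr _ _ (Fam1 _)); exists (fun i => enum_val (widen_ord rS i)).
  split; first by move=> i j /enum_val_inj/(congr1 val)/= /val_inj.
  move=> i j; rewrite adj_graph_of_rel andbT => ij; apply: clS; try exact: enum_valP.
  by apply: contraNneq ij => /enum_val_inj/(congr1 val)/= /val_inj ->.
have := cf [set f i | i : 'I_r]; rewrite card_imset // card_ord ltnn.
suff H : forall x y, x \in [set f i | i : 'I_r] -> y \in [set f i | i : 'I_r] ->
    x != y -> adj G x y by move=> /(_ H).
move=> _ _ /imsetP[i _ ->] /imsetP[j _ ->] ij; apply: hf.
by rewrite adj_graph_of_rel andbT; apply: contraNneq ij => ->.
Qed.

Lemma free_cycles k G : 2 < k ->
  free (cycles_ge k) G <-> no_cycle_ge k (adj G).
Proof.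
move=> k3; split=> [fr c cc uc|nc W H0 [l l3 kl] [f [injf hf]]].
  rewrite ltnNge; apply/negP => kc.
  have c3 : 2 < size c := leq_trans k3 kc.
  apply: (fr _ _ (CyclesGe c3 kc)).
  case: c cc uc {kc} c3 => // x p cc uc c3.
  exists (fun i : 'I_(size (x :: p)) => nth x (x :: p) i); split.
    by move=> i j /eqP; rewrite nth_uniq // => /eqP/val_inj.
  have step (i : 'I_(size (x :: p))) : adj G (nth x (x :: p) i) (nth x (x :: p) (ordS i)).
    have := ltn_ord i; have := pathP x cc i; rewrite size_rcons -rcons_cons => H hi.
    have := H hi; rewrite !nth_rcons hi /=.
    have [ip|ip] := ltnP i (size p); first by rewrite modn_small.
    have -> : i = size p :> nat by apply/eqP; rewrite eqn_leq ip andbT -ltnS.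
    by rewrite eqxx modnn.
  move=> i j; rewrite adj_graph_of_rel => /andP[_ /orP[]/eqP->] //.
  by rewrite adj_sym.
case: l l3 kl f injf hf => // l l3 kl f injf hf.
pose g i := f (inord i).
have /nc : cycle (adj G) (map g (iota 0 l.+1)).
  rewrite cycle_map /=; apply/(pathP 0) => i; rewrite size_rcons size_iota => il.
  rewrite -rcons_cons -[0 :: iota 1 l]/(iota 0 l.+1) !nth_rcons !size_iota il.
  rewrite nth_iota // add0n /=; apply: hf; rewrite adj_graph_of_rel; apply/andP.
  have E : inord (if i < l then nth 0 (iota 1 l) i else if i == l then 0 else 0) =
      ordS (inord i : 'I_l.+1).
    apply: val_inj; rewrite /= !inordK //.
      have [h|h] := ltnP i l; first by rewrite nth_iota // modn_small.
      by rewrite if_same (_ : i = l) ?modnn //; lia.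
    have [h|h] := ltnP i l; last by rewrite if_same.
    by rewrite nth_iota.
  rewrite E eqxx; split=> //.
  apply/eqP => /(congr1 val) /=; rewrite inordK //.
  have [h|h] := ltnP i l; first by rewrite modn_small //; lia.
  by rewrite (_ : i = l) ?modnn; lia.
rewrite size_map size_iota map_inj_in_uniq ?iota_uniq => [/(_ isT)|i j]; first by lia.
by rewrite !mem_iota /= => il jl /injf/(congr1 val); rewrite /= !inordK.
Qed.

Lemma free_clique_cycles k r G : 2 < k ->
  free (famU (fam1 (complete_graph 'I_r)) (cycles_ge k)) G <->
  cliquefree r (adj G) /\ no_cycle_ge k (adj G).
Proof.
move=> k3; rewrite -free_complete -(free_cycles _ k3).
by split=> [H|[H1 H2] W H0 [/H1|/H2] //]; split=> W H0 h; apply: H; [left|right].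
Qed.
End Translation.

Section Extremal.
Variable F : Defs.family.

Lemma num_edges_le_ex n (G : sgraph 'I_n) : free F G -> num_edges G <= ex n F.
Proof.
by move=> fG; apply: (@leq_bigmax_cond _ _ (@num_edges _)); apply/asboolP.
Qed.

Lemma ex_attained n (G0 : sgraph 'I_n) : free F G0 ->
  exists2 G : sgraph 'I_n, free F G & num_edges G = ex n F.
Proof.
move=> fG.
have [|G fG' E] := @eq_bigmax_cond _ (fun G : sgraph 'I_n => `[< free F G >])
    (@num_edges _).
  by apply/card_gt0P; exists G0; apply/asboolP.
by exists G => //; apply/asboolP.
Qed.

End Extremal.

Lemma arcs_reindex (V W : finType) (f : W -> V) (e : rel V) :
  bijective f -> arcs (relpre f e) setT = arcs e setT.
Proof.
move=> bf; have bf' : {on [pred y | y \in [set: V]], bijective f} by apply: onW_bij.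
rewrite /arcs [RHS](reindex f) //=; apply: eq_big => x; first by rewrite !inE.
move=> _; rewrite /ndeg [RHS](reindex f) //=; apply: eq_bigl => y.
by rewrite !inE.
Qed.

Lemma arcs_eq (V : finType) (e e' : rel V) S : e =2 e' -> arcs e S = arcs e' S.
Proof.
by move=> E; apply: eq_bigr => x _; apply: eq_bigr => y _; rewrite E.
Qed.

(** Extremal numbers are defined on ordinals, whereas gluing and joining
    naturally produce graphs on sum types. *)
Lemma transport (V : finType) (e : rel V) : symmetric e -> irreflexive e ->
  exists (f : 'I_#|V| -> V) (G : sgraph 'I_#|V|),
    [/\ injective f, adj G =2 relpre f e & (num_edges G).*2 = arcs e setT].
Proof.
move=> se ie; exists (@enum_val V predT); set f := enum_val.
have fb : bijective f by exact: enum_val_bij.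
have fi := bij_inj fb.
exists (graph_of_rel (relpre f e)).
have E : adj (graph_of_rel (relpre f e)) =2 relpre f e.
  move=> x y; rewrite adj_graph_of_rel /= [e (f y) _]se orbb.
  by have [->|] := eqVneq x y; rewrite ?ie.
by split=> //; rewrite -arcs_num_edges (arcs_eq _ E) arcs_reindex.
Qed.

Lemma cliquefree_eq (V : finType) r (e e' : rel V) :
  e =2 e' -> cliquefree r e -> cliquefree r e'.
Proof. by move=> E cf S clS; apply: cf => x y xS yS xy; rewrite E; apply: clS. Qed.

Lemma no_cycle_ge_eq (V : finType) k (e e' : rel V) :
  e =2 e' -> no_cycle_ge k e -> no_cycle_ge k e'.
Proof. by move=> E nc c; rewrite -(eq_cycle E); apply: nc. Qed.

(** * Turan graphs with classes of size at most two *)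

Section Turan.
Variable r : nat.
Let Kr : Defs.family := fam1 (complete_graph 'I_r).

Lemma arcs_le_ex_clique (V : finType) (e : rel V) :
  symmetric e -> irreflexive e -> cliquefree r e -> arcs e setT <= (ex #|V| Kr).*2.
Proof.
move=> se ie cf; have [f [G [fi GE <-]]] := transport se ie.
rewrite leq_double; apply/num_edges_le_ex/free_complete.
by apply: cliquefree_eq (cliquefree_pullback fi cf) => x y; rewrite GE.
Qed.

Hypothesis r2 : 1 < r.

Lemma empty_cliquefree n : cliquefree r (adj (empty_graph 'I_n)).
Proof.
move=> S clS; rewrite ltnNge; apply/negP => rS.
have /card_gt1P[x [y [xS yS xy]]] : 1 < #|S| by apply: leq_trans rS.
by have := clS x y xS yS xy; rewrite adj_graph_of_rel orbF andbF.
Qed.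

Lemma ex_clique_attained_rel n : exists e : rel 'I_n,
  [/\ symmetric e, irreflexive e, cliquefree r e & arcs e setT = (ex n Kr).*2].
Proof.
have f0 : free Kr (empty_graph 'I_n) by apply/free_complete; exact: empty_cliquefree.
have [G /free_complete cf <-] := ex_attained f0.
exists (adj G); split=> //; [exact: adj_sym|exact: adj_irr|exact: arcs_num_edges].
Qed.

(** Vertices are adjacent when they differ modulo the number of classes.  As
    there are at most twice as many vertices as classes, the vertex [m] is
    adjacent to all earlier ones except possibly [m - (r - 1)]. *)
Lemma turan_lower q : q.+1 <= (r - 1).*2 -> turan2 r q <= (ex q.+1 Kr).*2.
Proof.
set s := r - 1 => qs.
pose E i j := i %% s != j %% s.
pose e : rel 'I_q.+1 := fun i j => E i j.
have s0 : 0 < s by rewrite /s; lia.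
have se : symmetric e by move=> i j; rewrite /e /E eq_sym.
have ie : irreflexive e by move=> i; rewrite /e /E eqxx.
have cf : cliquefree r e.
  move=> S clS; pose f (i : 'I_q.+1) : 'I_s := Ordinal (ltn_pmod i s0).
  rewrite -(card_in_imset (f := f) (D := S)).
    by apply: leq_ltn_trans (max_card _) _; rewrite card_ord /s; lia.
  move=> i j iS jS /(congr1 val) /= ij; apply: contraTeq isT => nij.
  by have := clS i j iS jS nij; rewrite /e /E ij eqxx.
have := arcs_le_ex_clique se ie cf; rewrite card_ord; apply: leq_trans.
have -> : arcs e setT = \sum_(i < q.+1) \sum_(j < q.+1) E i j.
  by rewrite arcs_mkcond; apply: eq_bigr => x _; apply: eq_bigr => y _; rewrite !inE.
have row m : m < s.*2 -> m - (s <= m) <= \sum_(j < m) E m j.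
  move=> ms; have [sm|sm] := leqP s m.
    case: m ms sm => [|m] ms sm; first by lia.
    have js : m.+1 - s < m.+1 by lia.
    rewrite (bigD1 (Ordinal js)) //=; apply: leq_trans (leq_addl _ _).
    rewrite (eq_bigr (fun _ => 1)) => [|j jn].
      by rewrite sum1_card cardC1 card_ord subn1.
    apply/eqP; rewrite eqb1 /E; apply: contraNneq jn => mj.
    apply/eqP/val_inj => /=; have jm := ltn_ord j.
    have mE : m.+1 %% s = m.+1 - s.
      by rewrite -[in LHS](subnK sm) modnDr modn_small //; lia.
    have [sj|js'] := leqP s j; last by rewrite -mE mj modn_small.
    have jE : j %% s = j - s by rewrite -[in LHS](subnK sj) modnDr modn_small //; lia.
    by move: mj; rewrite mE jE; lia.
  rewrite subn0 (eq_bigr (fun _ => 1)) => [|j _]; first by rewrite sum1_card card_ord.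
  have jm := ltn_ord j.
  by apply/eqP; rewrite eqb1 /E !modn_small ?(ltn_trans jm) //; lia.
elim: q qs {e se ie cf} => [|q IH] qs; first by rewrite /turan2; lia.
rewrite big_ord_recr /=.
under eq_bigr => i _ do rewrite big_ord_recr /=.
rewrite big_split /= [\sum_(j < q.+2) _]big_ord_recr /=.
have -> : \sum_(i < q.+1) E i q.+1 = \sum_(j < q.+1) E q.+1 j.
  by apply: eq_bigr => i _; rewrite /E eq_sym.
have := row q.+1 qs; have := IH (ltnW qs).
move: (\sum_(i < q.+1) _) (\sum_(j < q.+1) _) => X Y.
have [sq|sq] := leqP s q.+1; rewrite /turan2 /s in sq *; nia.
Qed.

End Turan.

(** * Windmills *)

Section LowerBounds.
Variables (k r : nat).
Hypothesis k3 : 2 < k.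
Let Kr : Defs.family := fam1 (complete_graph 'I_r).
Let H : Defs.family := famU Kr (cycles_ge k).

Lemma arcs_le_ex_both (V : finType) (e : rel V) :
  symmetric e -> irreflexive e -> cliquefree r e -> no_cycle_ge k e ->
  arcs e setT <= (ex #|V| H).*2.
Proof.
move=> se ie cf nc; have [f [G [fi GE <-]]] := transport se ie.
rewrite leq_double; apply/num_edges_le_ex/free_clique_cycles => //; split.
  by apply: cliquefree_eq (cliquefree_pullback fi cf) => x y; rewrite GE.
by apply: no_cycle_ge_eq (no_cycle_ge_pullback fi nc) => x y; rewrite GE.
Qed.

Hypothesis r2 : 1 < r.

Lemma empty_no_cycle_ge n : no_cycle_ge k (adj (empty_graph 'I_n)).
Proof.
case=> [|x [|y c]] //=; rewrite ?adj_graph_of_rel ?andbF //; lia.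
Qed.

Lemma ex_attained_rel n : exists e : rel 'I_n,
  [/\ symmetric e, irreflexive e, cliquefree r e, no_cycle_ge k e &
      arcs e setT = (ex n H).*2].
Proof.
have f0 : free H (empty_graph 'I_n).
  by apply/free_clique_cycles => //; split; [exact: empty_cliquefree|exact: empty_no_cycle_ge].
have [G /free_clique_cycles [//|cf nc] <-] := ex_attained f0.
exists (adj G); split=> //; [exact: adj_sym|exact: adj_irr|exact: arcs_num_edges].
Qed.

(** A cycle has no more vertices than the graph. *)
Lemma ex_small n : n < k -> ex n Kr <= ex n H.
Proof.
move=> nk; have [e [se ie cf E]] := ex_clique_attained_rel r2 n.
rewrite -leq_double -E -[n in ex n H]card_ord; apply: arcs_le_ex_both => // c _ uc.
by rewrite -(card_uniqP uc) (leq_ltn_trans (max_card _)) ?card_ord.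
Qed.

Section Glue.
Variables (a b : nat) (e1 : rel 'I_a.+1) (e2 : rel 'I_b.+1).
Hypotheses (se1 : symmetric e1) (ie1 : irreflexive e1).
Hypotheses (se2 : symmetric e2) (ie2 : irreflexive e2).
Notation W := ('I_a.+1 + 'I_b)%type.

(** The vertex [ord0] of the second graph is identified with that of the first,
    so that only the other vertices of the second graph are added. *)
Definition glue : rel W := fun u v => match u, v with
  | inl x, inl y => e1 x y
  | inr x, inr y => e2 (lift ord0 x) (lift ord0 y)
  | inl x, inr y | inr y, inl x => (x == ord0) && e2 ord0 (lift ord0 y)
  end.

Definition projl (u : W) : 'I_a.+1 := if u is inl x then x else ord0.
Definition projr (u : W) : 'I_b.+1 := if u is inr y then lift ord0 y else ord0.
Definition onl (u : W) : bool := if u is inl _ then true else false.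
Definition onr (u : W) : bool := if u is inl x then x == ord0 else true.

Lemma glue_sym : symmetric glue.
Proof. by move=> [x|x] [y|y] //=. Qed.

Lemma glue_irr : irreflexive glue.
Proof. by move=> [x|x] /=. Qed.

Lemma projl_inj : {in onl &, injective projl}.
Proof. by move=> [x|x] [y|y] // _ _ /= ->. Qed.

Lemma projr_inj : {in onr &, injective projr}.
Proof.
move=> [x|x] [y|y]; rewrite -!topredE //=.
- by move=> /eqP-> /eqP->.
- by move=> _ _ /lift_inj ->.
Qed.

Lemma glue_l : {in onl &, subrel glue (relpre projl e1)}.
Proof. by move=> [x|x] [y|y]. Qed.

Lemma glue_r : {in onr &, subrel glue (relpre projr e2)}.
Proof.
move=> [x|x] [y|y]; rewrite -!topredE //=.
- by move=> /eqP-> /eqP->; rewrite ie1.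
- by move=> _ _ /andP[].
- by move=> _ _ /andP[_]; rewrite se2.
Qed.

Lemma glue_lr u v : glue u v -> onl u || onr v.
Proof. by case: u v => [x|x] [y|y] //= /andP[]. Qed.

Lemma glue_cliquefree : cliquefree r e1 -> cliquefree r e2 -> cliquefree r glue.
Proof.
move=> cf1 cf2 S clS.
have [/subsetP Sl|/subsetPn[u uS ul]] := boolP (S \subset onl).
  rewrite -(card_in_imset (f := projl) (D := S)).
    2: by move=> x y /Sl xl /Sl; apply: projl_inj.
  apply: cf1 => _ _ /imsetP[x xS ->] /imsetP[y yS ->] xy.
  apply: (glue_l (Sl x xS) (Sl y yS)); apply: clS => //.
  by apply: contraNneq xy => ->.
have Sr x : x \in S -> x \in onr.
  move=> xS; have [<-|ux] := eqVneq u x; first by case: (u) ul.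
  by have := glue_lr (clS u x uS xS ux); rewrite -!topredE /= in ul *; rewrite (negPf ul).
rewrite -(card_in_imset (f := projr) (D := S)).
  2: by move=> x y /Sr xl /Sr; apply: projr_inj.
apply: cf2 => _ _ /imsetP[x xS ->] /imsetP[y yS ->] xy.
apply: (glue_r (Sr x xS) (Sr y yS)); apply: clS => //.
by apply: contraNneq xy => ->.
Qed.

(** Along a path that avoids the common vertex the side cannot change. *)
Lemma glue_path_side u p : path glue u p -> inl ord0 \notin u :: p ->
  all onl (u :: p) || all onr (u :: p).
Proof.
suff side : path glue u p -> inl ord0 \notin u :: p ->
    all (fun v => (v == inl ord0) || (onl v == onl u)) (u :: p).
  move=> ep np; have /allP al := side ep np.
  have [ul|ul] := boolP (onl u); [apply/orP; left|apply/orP; right].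
    apply/allP => v /[dup] vp /al; rewrite ul => /orP[/eqP->//|/eqP //].
  apply/allP => v /[dup] vp /al; rewrite (negPf ul) => /orP[/eqP->//|/eqP].
  by case: (v).
elim: p u => [|v p IH] u /=; first by rewrite eqxx orbT.
case/andP=> uv ep; rewrite inE negb_or => /andP[u0 np].
have := IH v ep np; rewrite eqxx orbT /= => /andP[_ al].
have v0 : inl ord0 != v by move: np; rewrite inE negb_or => /andP[].
have luv : onl v = onl u.
  move: u v uv u0 v0 {IH ep np al} => [x|x] [y|y] //= /andP[/eqP-> _]; by rewrite eqxx.
by rewrite luv eqxx orbT -luv.
Qed.

(** A cycle through the common vertex is rotated so as to start there; the rest
    is a path that avoids it. *)
Lemma glue_cycle_side c : cycle glue c -> uniq c -> all onl c || all onr c.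
Proof.
have [/rot_to[i q rE]|nc] := boolP (inl ord0 \in c); last first.
  case: c nc => // u p np; rewrite /= rcons_path => /andP[ep _] _.
  exact: glue_path_side.
rewrite -(rot_cycle i) -(rot_uniq i) -!(eq_all_r (mem_rot i c)) rE.
case: q {rE} => // u p; rewrite [cycle _ _]/= rcons_path cons_uniq => /andP[_ /andP[ep _]].
by case/andP=> np _; have H1 := glue_path_side ep np; exact: H1.
Qed.

Lemma glue_no_cycle_ge : no_cycle_ge k e1 -> no_cycle_ge k e2 -> no_cycle_ge k glue.
Proof.
move=> nc1 nc2 c cc uc; case/orP: (glue_cycle_side cc uc) => al.
  rewrite -(size_map projl); apply: nc1.
    by rewrite cycle_map; exact: (sub_in_cycle (P := onl) glue_l al cc).
  rewrite map_inj_in_uniq // => x y xc yc; apply: projl_inj; exact: (allP al).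
rewrite -(size_map projr); apply: nc2.
  by rewrite cycle_map; exact: (sub_in_cycle (P := onr) glue_r al cc).
rewrite map_inj_in_uniq // => x y xc yc; apply: projr_inj; exact: (allP al).
Qed.

Lemma arcs_glue : arcs glue setT = arcs e1 setT + arcs e2 setT.
Proof.
have arcsT (T : finType) (e : rel T) : arcs e setT = \sum_x \sum_y e x y.
  by rewrite arcs_mkcond; apply: eq_bigr => x _; apply: eq_bigr => y _; rewrite !inE.
rewrite !arcsT big_sumType /=.
under eq_bigr => x _ do rewrite big_sumType /=.
under [X in _ + X]eq_bigr => x _ do rewrite big_sumType /=.
rewrite !big_split /= -addnA; congr (_ + _).
rewrite [RHS]big_ord_recl [X in _ = X + _]big_ord_recl ie2 add0n.
have -> : \sum_(x < a.+1) \sum_(y < b) (x == ord0) && e2 ord0 (lift ord0 y) =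
          \sum_(y < b) e2 ord0 (lift ord0 y).
  rewrite big_ord_recl [X in _ + X]big1 ?addn0 => [|x _].
    by apply: eq_bigr => y _; rewrite eqxx.
  by apply: big1 => y _; rewrite eq_sym (negPf (neq_lift _ _)).
congr (_ + _); under [RHS]eq_bigr => x _ do rewrite big_ord_recl.
rewrite big_split /=; congr (_ + _).
by apply: eq_bigr => y _; rewrite big_ord_recl eqxx se2 big1 ?addn0.
Qed.
End Glue.

Lemma ex_glue a b : ex a.+1 H + ex b.+1 H <= ex (a + b).+1 H.
Proof.
have [e1 [s1 i1 cf1 nc1 E1]] := ex_attained_rel a.+1.
have [e2 [s2 i2 cf2 nc2 E2]] := ex_attained_rel b.+1.
rewrite -leq_double doubleD -E1 -E2 -arcs_glue //.
have -> : (a + b).+1 = #|{: 'I_a.+1 + 'I_b}| by rewrite card_sum !card_ord.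
apply: arcs_le_ex_both.
- exact: glue_sym.
- exact: glue_irr.
- exact: glue_cliquefree.
- exact: glue_no_cycle_ge.
Qed.

Lemma ex_windmill p q : q <= k - 2 ->
  p * ex (k - 1) Kr + ex (q + 1) Kr <= ex (p * (k - 2) + q).+1 H.
Proof.
move=> qk; elim: p => [|p IH]; first by rewrite !mul0n !add0n addn1; apply: ex_small; lia.
have := ex_glue (k - 2) (p * (k - 2) + q).
have -> : k - 2 + (p * (k - 2) + q) = p.+1 * (k - 2) + q by rewrite mulSn addnA.
have -> : (k - 2).+1 = k - 1 by lia.
apply: leq_trans; rewrite mulSn -addnA; apply: leq_add => //.
by apply: ex_small; lia.
Qed.

End LowerBounds.

(** * A clique joined to an independent set *)

Section CompleteSplit.
Variables h m : nat.
Let G1 := join (complete_graph 'I_h) (empty_graph 'I_m).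
Let V := ('I_h + 'I_m)%type.

Lemma adj_complete_split (u v : V) : adj G1 u v =
  match u, v with inl x, inl y => x != y | inr _, inr _ => false | _, _ => true end.
Proof.
rewrite adj_graph_of_rel; case: u v => [x|x] [y|y] //=.
- rewrite !adj_graph_of_rel !orbT !andbT [y == x]eq_sym orbb.
  by have -> : (inl x != inl y :> V) = (x != y) by []; case: (x != y).
- by rewrite !adj_graph_of_rel !andbF.
Qed.

Lemma num_edges_complete_split : (num_edges G1).*2 = h * h.-1 + (h * m).*2.
Proof.
rewrite -arcs_num_edges arcs_mkcond big_sumType /=.
rewrite (eq_bigr (fun _ => h.-1 + m)) => [|x _]; last first.
  rewrite big_sumType /= (bigD1 x) //= !inE /= adj_complete_split eqxx add0n; congr (_ + _).
    rewrite (eq_bigr (fun _ => 1)) => [|y yx].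
      by rewrite sum1_card cardC1 card_ord.
    by rewrite !inE /= adj_complete_split eq_sym yx.
  rewrite (eq_bigr (fun _ => 1)) => [|y _]; last by rewrite !inE /= adj_complete_split.
  by rewrite sum1_card card_ord.
rewrite (eq_bigr (fun _ : 'I_m => h)) => [|x _]; last first.
  rewrite big_sumType /= addnC big1 => [|y _]; last by rewrite !inE /= adj_complete_split.
  rewrite (eq_bigr (fun _ => 1)) => [|y _]; last by rewrite !inE /= adj_complete_split.
  by rewrite sum1_card card_ord.
by rewrite !sum_nat_const !card_ord mulnDr -addnn -addnA [m * h]mulnC.
Qed.

(** A clique has at most one vertex in the independent part, so sending all of
    that part to [None] is injective on it. *)
Lemma complete_split_cliquefree r : h.+1 < r -> cliquefree r (adj G1).
Proof.
move=> hr S clS; pose f (u : V) : option 'I_h := if u is inl x then Some x else None.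
rewrite -(card_in_imset (f := f) (D := S)).
  by apply: leq_ltn_trans (max_card _) _; rewrite card_option card_ord.
move=> [x|x] [y|y] xS yS //= => [[->] //|_].
by apply/eqP; apply: contraT => xy; have := clS _ _ xS yS xy; rewrite adj_complete_split.
Qed.

(** The successor of an independent vertex on a cycle lies in the clique part,
    and distinct vertices have distinct successors. *)
Lemma complete_split_no_cycle_ge k : h.*2 < k -> no_cycle_ge k (adj G1).
Proof.
move=> hk c cc uc; apply: leq_ltn_trans hk.
pose isl (u : V) := if u is inl _ then true else false.
have nl : size (filter isl c) <= h.
  rewrite -(card_uniqP (filter_uniq isl uc)) -[h in _ <= h]card_ord.
  pose f (i : 'I_h) : V := inl i.
  rewrite -(card_imset (f := f)) //; last by move=> i j [].
  apply/subset_leq_card/subsetP => -[x|x]; rewrite mem_filter //= => _.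
  by apply/imsetP; exists x.
rewrite -(count_predC isl c) -!size_filter -addnn leq_add //.
apply: leq_trans nl; rewrite -(size_map (next c)); apply: uniq_leq_size.
  rewrite map_inj_uniq ?filter_uniq //.
  by apply: can_inj (prev_next uc).
move=> _ /mapP[u + ->]; rewrite !mem_filter mem_next => /andP[/= ul uc'].
rewrite uc' andbT; have := next_cycle cc uc'; rewrite adj_complete_split.
by case: u ul {uc'} => // x _; case: (next _ _).
Qed.
End CompleteSplit.

Theorem theorem4 (k r n p q : nat)
    (hn : n - 1 = p * (k - 2) + q) (hq : q <= k - 3) :
  let Kr := fam1 (complete_graph 'I_r) in
  let H := famU Kr (cycles_ge k) in
  let f := p * ex (k - 1) Kr + ex (q + 1) Kr in
  let h := (k - 1) %/ 2 in
  let G1 := join (complete_graph 'I_h) (empty_graph 'I_(n - h)) in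
  (6 <= k -> ~~ odd k -> h + 2 <= r -> r < k -> k <= n ->
     ex n H = f)
  /\
  (5 <= k -> odd k -> h + 2 <= r -> r < k -> k <= n ->
     ex n H = maxn f (num_edges G1)).
Proof.
move=> Kr H f h G1.
have hE : 4 < k -> h = k.-1./2 by rewrite /h divn2 subn1.
clearbody h.
have lower : 4 < k -> h + 2 <= r -> k <= n -> f <= ex n H.
  move=> k5 hr kn; have -> : n = (p * (k - 2) + q).+1 by rewrite -hn; lia.
  by apply: ex_windmill; lia.
have windmill_f : 4 < k -> h + 2 <= r -> r < k -> k <= n -> windmill2 k r n.-1 <= f.*2.
  move=> k5 hr rk kn; have h2 := hE k5.
  rewrite -subn1 hn windmill2E; try lia.
  rewrite doubleD doubleMr leq_add // ?leq_mul2l.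
    by apply/orP; right; have := @turan_lower r _ (k - 2);
       rewrite (_ : (k - 2).+1 = k - 1); [apply; lia|lia].
  by rewrite addn1; apply: turan_lower; lia.
have upper (k5 : 4 < k) (hr : h + 2 <= r) (rk : r < k) (kn : k <= n)
    (G : sgraph 'I_n) : free H G -> edge_bound k r h n.-1 (num_edges G).*2.
  case/free_clique_cycles => [|cf nc]; first lia.
  have := @upper_bound k r h (hE k5) _ _ rk _ (adj G) (@adj_sym _ G) (@adj_irr _ G) nc cf.
  rewrite card_ord arcs_num_edges; apply; have := hE k5; lia.
split=> k5 ok hr rk kn.
  have k5' : 4 < k by lia.
  apply/eqP; rewrite eqn_leq lower // andbT; apply/bigmax_leqP => G /asboolP fG.
  rewrite -leq_double; apply: leq_trans (windmill_f k5' hr rk kn).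
  by apply: even_bound (upper k5' hr rk kn G fG); have := hE k5'; lia.
have hk := hE k5; have nG1 : #|{: 'I_h + 'I_(n - h)}| = n.
  by rewrite card_sum !card_ord; lia.
apply/eqP; rewrite eqn_leq geq_max lower //=; apply/andP; split; last first.
  rewrite -leq_double -arcs_num_edges -[n in ex n H]nG1.
  apply: arcs_le_ex_both; [lia|exact: adj_sym|exact: adj_irr| |].
    by apply: complete_split_cliquefree; lia.
  by apply: complete_split_no_cycle_ge; lia.
apply/bigmax_leqP => G /asboolP /(upper k5 hr rk kn) [B|B].
  by rewrite leq_max -leq_double (leq_trans B) // windmill_f.
rewrite leq_max -[num_edges G <= num_edges G1]leq_double num_edges_complete_split.
apply/orP; right.
move: (num_edges G) B => g B.
have [m nE] : exists m, n = h + m by exists (n - h); lia.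
have [c hc] : exists c, h = c.+1 by exists h.-1; lia.
move: B; rewrite nE addKn hc /=; nia.
Qed.
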